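(* Let $k,b,p\ge 1$ be integers, $N=kb$, $\sigma>0$, $\alpha\ge 2$ an integer, and let $\mathbf{C}\in\mathbb{R}^{N\times N}$ be a lower-triangular strategy matrix with non-negative entries. Let $\mathcal{A}$ be the algorithm specified step by step in the context (the ''remove''-direction Rényi accountant), which takes $\mathbf{C}$, the bandwidth $p$, the number $b$ of batches per epoch and the order $\alpha$ as input (with $k$ and $\sigma$ given) and returns a number $\rho$. Let $$V=\frac{1}{\alpha-1}\log\sum_{(r_1,\dots,r_\alpha)\in\{1,\dots,b\}^\alpha}\exp\Bigg(\sum_{\substack{j_1,j_2=1\\ j_1\neq j_2}}^{\alpha}\frac{\mathbf{G}_{r_{j_1},r_{j_2}}}{2\sigma^2}\Bigg)-\frac{\alpha\log b}{\alpha-1},$$ which is the Rényi divergence $R_\alpha(\hat P\|\hat Q)$ of the pair $(\hat P,\hat Q)$ defined in the context. Then algorithm $\mathcal{A}$ computes $V$ exactly (i.e. $\rho=V$) if $\mathbf{C}$ is $p$-banded, and returns an upper bound on $V$ (i.e. $\rho\ge V$) otherwise. The algorithm $\mathcal{A}$ runs in time $O(b\,p\,\alpha^{2p})$ and requires $O(\alpha^{p}+bp)$ memory.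
   Context: **Objects.** For $1\le i\le b$ let $\mathbf{m}_i=\sum_{j=0}^{k-1}|\mathbf{C}|_{:,\,i+jb}\in\mathbb{R}^N$ (the sum of columns $i,i+b,\dots,i+(k-1)b$ of the entrywise absolute value of $\mathbf{C}$), and let $\mathbf{G}\in\mathbb{R}^{b\times b}$ be the Gram matrix $\mathbf{G}_{i,j}=\langle\mathbf{m}_i,\mathbf{m}_j\rangle$. Let $\hat P=\frac1b\sum_{i=1}^b\mathcal{N}(\mathbf{m}_i,\sigma^2I_N)$ and $\hat Q=\mathcal{N}(0,\sigma^2I_N)$. The Rényi divergence is $R_\alpha(P\|Q)=\frac{1}{\alpha-1}\log\mathbb{E}_{x\sim P}\big[(\tfrac{dP}{dQ}(x))^{\alpha-1}\big]$. The lower-triangular matrix $\mathbf{C}$ is $p$-banded if $\mathbf{C}_{s,t}=0$ whenever $s-t\ge p$. LSE denotes log-sum-exp, $\operatorname{LSE}(x,y)=\log(e^x+e^y)$, with $\log 0=-\infty$. **Algorithm $\mathcal{A}$.** 1. Compute $\mathbf{m}_i$ for all $i$ and $\mathbf{G}_{i,j}=\langle\mathbf{m}_i,\mathbf{m}_j\rangle$ for all $i,j\in\{1,\dots,b\}$. 2. Set $\tau\leftarrow\max\{\mathbf{G}_{i,j}:\min(|i-j|,b-|i-j|)\ge p\}$ ($\tau=0$ if there is no such pair). Set $\mathbf{G}^{(p)}_{i,j}\leftarrow\max(\mathbf{G}_{i,j}-\tau,0)$ when $\min(|i-j|,b-|i-j|)<p$, and $\mathbf{G}^{(p)}_{i,j}=0$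 otherwise. From here on, rows and columns of $\mathbf{G}^{(p)}$ are indexed by $0,\dots,b-1$. 3. Set $\log S\leftarrow-\infty$. Loop over all tuples $l=(l_0,\dots,l_{p-2})$ of non-negative integers with $m_l:=\sum_{i=0}^{p-2}l_i\le\alpha$ (only the empty tuple, with $m_l=0$, if $p=1$). For each $l$: (a) Set $\log w_l\leftarrow\sum_{0\le i<j\le p-2}\mathbf{G}^{(p)}_{i,j}\frac{l_il_j}{\sigma^2}+\sum_{i=0}^{p-2}\Big[\mathbf{G}^{(p)}_{i,i}\frac{l_i(l_i-1)}{2\sigma^2}-\log(l_i!)\Big]$, and initialise a dictionary states $=\{(m_l,l)\mapsto\log w_l\}$. A key $(m,r)$ consists of a partial sum $m$ and a suffix tuple $r$ holding the last $p-1$ values; missing keys have value $-\infty$. (b) For $q=p-1,\dots,b-1$: start with an empty dictionary new_states. For every key $(m,r)$ of states, with value $\log w$ and with $L$ the length of $r=(r_0,\dots,r_{L-1})$, set $S_1\leftarrow2\sum_{i=0}^{L-1}\mathbf{G}^{(p)}_{q,\,q-L+i}\,r_i$. For each $t=0,\dots,\alpha-m$ set $$\Delta\leftarrow\frac{\mathbf{G}^{(p)}_{q,q}\,t(t-1)+S_1t}{2\sigma^2}-\log(t!),\qquad m'\leftarrow m+t,$$ let $r'=()$ if $p=1$, $r'=(r_0,\dots,r_{L-1},t)$ if $L<p-1$, and $r'=(r_1,\dots,r_{L-1},t)$ otherwise, and update new_states$(m',r')\leftarrow\operatorname{LSE}\big(\log w+\Delta,\ \text{new\_states}(m',r')\big)$.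 After all keys are processed, set states $\leftarrow$ new_states. (c) Set $\log S_l\leftarrow-\infty$. For every key $(m,r)$ of states with $m=\alpha$, with $L$ the length of $r$, set $\log S_{l,r}\leftarrow\sum_{i,j=0}^{p-2}\frac{\mathbf{G}^{(p)}_{i,\,b-1-j}\,l_i\,r_{L-1-j}}{\sigma^2}$ (the interactions between the last and the first $p-1$ indices) and $\log S_l\leftarrow\operatorname{LSE}\big(\log S_l,\ \text{states}(m,r)+\log S_{l,r}\big)$. (d) Set $\log S\leftarrow\operatorname{LSE}(\log S,\log S_l)$. 4. Return $$\rho=\frac{\log S+\log(\alpha!)-\alpha\log b}{\alpha-1}+\frac{\tau\alpha}{2\sigma^2}.$$
   Formalization: Exactness is stated only for b ≥ 3(p-1): for smaller b step 3(c) recounts pairs (b=p=2 fails). Time and memory exclude computing and storing C, the m_i and all G_{i,j}, and finding τ, since the b² inner products of length kb already exceed the bounds. *)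

(* Defs.v *)
From HB Require Import structures.
From mathcomp Require Import all_boot all_order all_algebra.
From mathcomp Require Import finmap.
From mathcomp Require Import all_classical all_reals all_analysis.

Set Implicit Arguments.
Unset Strict Implicit.
Unset Printing Implicit Defensive.

Import Order.TTheory GRing.Theory Num.Theory.
Import numFieldNormedType.Exports.

Local Open Scope classical_set_scope.
Local Open Scope ring_scope.

(* Indices are 0-based throughout: column i + jb of the text (1 <= i <= b) is
   the ordinal j * b + i with i < b. *)

Section Gram.
Variables (R : realType) (k b : nat).
Implicit Type C : 'M[R]_(k * b).

Lemma batch_col_proof (i : 'I_b) (j : 'I_k) : (j * b + i < k * b)%N.
Proof.
apply: (@leq_trans (j.+1 * b)%N); first by rewrite mulSn addnC ltn_add2r.
by rewrite leq_mul2r ltn_ord orbT.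
Qed.

Definition batch_col (i : 'I_b) (j : 'I_k) : 'I_(k * b) :=
  Ordinal (batch_col_proof i j).

Definition mean_vec C (i : 'I_b) : 'cV[R]_(k * b) :=
  \sum_(j < k) col (batch_col i j) (map_mx (fun x => `|x|) C).

Definition gram C : 'M[R]_b :=
  \matrix_(i, j) \sum_(s < k * b) mean_vec C i s 0 * mean_vec C j s 0.

Definition lower_triangular C : Prop :=
  forall s t : 'I_(k * b), (s < t)%N -> C s t = 0.

Definition banded (p : nat) C : Prop :=
  forall s t : 'I_(k * b), (t + p <= s)%N -> C s t = 0.

Definition V_alpha (sigma : R) (alpha : nat) C : R :=
  (alpha%:R - 1)^-1 *
    ln (\sum_(r : {ffun 'I_alpha -> 'I_b})
          expR (\sum_(j1 < alpha) \sum_(j2 < alpha | j1 != j2)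
                  gram C (r j1) (r j2) / (2 * sigma ^+ 2)))
  - alpha%:R * ln b%:R / (alpha%:R - 1).

End Gram.

Section Renyi.
Variable R : realType.
Local Open Scope ereal_scope.
Local Notation Rm := (measurableTypeR R).

Definition tcons n (x : Rm * n.-tuple Rm) : n.+1.-tuple Rm :=
  [the n.+1.-tuple Rm of x.1 :: x.2].

Lemma measurable_tcons n :
  measurable_fun [set: (Rm * n.-tuple Rm)%type] (@tcons n).
Proof. exact: (measurable_cons measurable_fst measurable_snd). Qed.

HB.instance Definition _ n :=
  isMeasurableFun.Build _ _ _ _ (@tcons n) (@measurable_tcons n).

(* N(mu, sigma^2 I_n), as the product of the N(mu_s, sigma^2) *)
Fixpoint gaussian (sigma : R) (n : nat) :
    n.-tuple R -> probability (n.-tuple Rm) R :=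
  match n with
  | 0%N => fun=> \d_([tuple] : 0.-tuple Rm)
  | n'.+1 => fun mu =>
      distribution (normal_prob (thead mu) sigma
                      \x gaussian sigma [tuple of behead mu])
        (@tcons n')
  end.

Section mixture.
Context d (T : measurableType d) (b : nat) (P : 'I_b -> probability T R).

Definition unif_mixture (A : set T) : \bar R :=
  (b%:R^-1)%:E * \sum_(i < b) P i A.

Let unif_mixture0 : unif_mixture set0 = 0.
Proof. by rewrite /unif_mixture big1 ?mule0// => i _; rewrite measure0. Qed.

Let unif_mixture_ge0 A : 0 <= unif_mixture A.
Proof.
rewrite /unif_mixture mule_ge0 ?lee_fin ?invr_ge0//.
by apply: sume_ge0 => i _; exact: measure_ge0.
Qed.

Let unif_mixture_sigma_additive : semi_sigma_additive unif_mixture.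
Proof.
move=> F mF tF mUF; rewrite /unif_mixture.
have sumP : (fun n => \sum_(i < b) \sum_(0 <= j < n) P i (F j)) @ \oo -->
    \sum_(i < b) P i (\bigcup_n F n).
  apply: cvg_nnesum => i _; last exact: measure_semi_sigma_additive.
  by apply: nearW => n; apply: sume_ge0 => j _; exact: measure_ge0.
have := @cvgeZl _ _ _ _ _ (b%:R^-1)%:E isT sumP.
set f := (X in X @ _ --> _ -> _); set g := (X in _ -> X @ _ --> _).
suff -> : g = f by apply.
apply/funext => n; rewrite /f /g -ge0_sume_distrr.
  by rewrite exchange_big.
by move=> j _; apply: sume_ge0 => i _; exact: measure_ge0.
Qed.

HB.instance Definition _ := isMeasure.Build _ _ _ unif_mixture
  unif_mixture0 unif_mixture_ge0 unif_mixture_sigma_additive.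

Let unif_mixture_fin : fin_num_fun unif_mixture.
Proof.
move=> A mA; rewrite /unif_mixture fin_numM//.
by apply/sum_fin_numP => i _ _; exact: fin_num_measure.
Qed.

HB.instance Definition _ :=
  Measure_isFinite.Build _ _ _ unif_mixture unif_mixture_fin.

End mixture.

Local Open Scope charge_scope.

Definition renyi (a : R) d (T : measurableType d)
    (P Q : {finite_measure set T -> \bar R}) : \bar R :=
  ((a - 1)^-1)%:E *
  lne (\int[P]_x (('d (charge_of_finite_measure P) '/d Q) x `^ (a - 1))).

Definition P_hat k b (sigma : R) (C : 'M[R]_(k * b)) :=
  unif_mixture (fun i : 'I_b =>
    gaussian sigma [tuple mean_vec C i s 0%R | s < (k * b)%N]).

Definition Q_hat k b (sigma : R) :=
  gaussian sigma [tuple (0 : R)%R | s < (k * b)%N].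

End Renyi.

(* Programs with a meter: time counts elementary operations, live the words of
   storage currently in use and peak the largest value of live so far. *)

Record meter := Meter { time : nat; live : nat; peak : nat }.

Definition prog (A : Type) : Type := meter -> A * meter.

Section Prog.
Implicit Types A B : Type.

Definition ret A (a : A) : prog A := fun c => (a, c).

Definition bind A B (x : prog A) (f : A -> prog B) : prog B :=
  fun c => let: (a, c') := x c in f a c'.

Definition tick (n : nat) : prog unit :=
  fun c => (tt, Meter (time c + n) (live c) (peak c)).

Definition alloc (n : nat) : prog unit :=
  fun c => (tt, Meter (time c) (live c + n) (maxn (peak c) (live c + n))).

Definition release (n : nat) : prog unit :=
  fun c => (tt, Meter (time c) (live c - n) (peak c)).

Definition run A (x : prog A) : A * meter := x (Meter 0 0 0).

End Prog.

Notation "'let!' x ':=' m 'in' f" := (bind m (fun x => f))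
  (at level 200, x name, m at level 100, f at level 200,
   format "'let!'  x  ':='  m  'in' '//' f").

(* a value obtained with n arithmetic operations or memory accesses *)
Definition compute A (n : nat) (a : A) : prog A := let! _ := tick n in ret a.

(* one unit of loop overhead per iteration *)
Fixpoint foldM (I A : Type) (f : I -> A -> prog A) (s : seq I) (a : A) : prog A :=
  if s is i :: s' then
    let! _ := tick 1 in let! a' := f i a in foldM f s' a'
  else ret a.

Definition sumM (R : realType) (I : Type) (s : seq I) (F : I -> prog R) : prog R :=
  foldM (fun i acc => let! x := F i in compute 1 (acc + x)) s 0.

(* A key (m, r) takes one word for m and one for each entry of r, and an entry
   one more for its value; accessing a key (hashing and comparing it) costs
   its length. *)

Section Dictionary.
Variable R : realType.

Definition key : Type := (nat * seq nat)%type.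
Definition dict : Type := {fmap key -> \bar R}.

Definition key_size (x : key) : nat := (size x.2).+1.
Definition keys (s : dict) : seq key := enum_fset (domf s).

Definition dict_get (s : dict) (x : key) : prog (\bar R) :=
  compute (key_size x) (odflt -oo%E s.[? x]%fmap).

Definition dict_set (s : dict) (x : key) (v : \bar R) : prog dict :=
  let! _ := tick (key_size x).+1 in
  let! _ := alloc (if x \in domf s then 0%N else (key_size x).+1) in
  ret s.[x <- v]%fmap.

Definition dict_free (s : dict) : prog unit :=
  release (\sum_(x <- keys s) (key_size x).+1)%N.

End Dictionary.

Definition LSE (R : realType) (x y : \bar R) : \bar R :=
  lne (expeR x + expeR y)%E.

(* the sequences of length n of natural numbers with sum at most s *)
Fixpoint tuples (n s : nat) : seq (seq nat) :=
  if n is n'.+1 then [seq t :: l | t <- iota 0 s.+1, l <- tuples n' (s - t)]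
  else [:: [::]].

Section Accountant.
Variables (R : realType) (b : nat) (G : 'M[R]_b) (p alpha : nat) (sigma : R).

Definition circ_dist (i j : 'I_b) : nat := minn `|i - j|%N (b - `|i - j|%N).

(* G is entrywise nonnegative, so 0 as initial value changes the maximum only
   when there is no pair. *)
Definition tau : R :=
  \big[Num.max/0]_(x : 'I_b * 'I_b | (p <= circ_dist x.1 x.2)%N) G x.1 x.2.

Definition band : 'M[R]_b := \matrix_(i, j)
  if (circ_dist i j < p)%N then Num.max (G i j - tau) 0 else 0.

(* Indices outside 0..b-1, which the program reads only if b < p - 1, give 0. *)
Definition entry (i j : nat) : R :=
  match insub i, insub j with
  | Some i', Some j' => band i' j'
  | _, _ => 0
  end.

(* entry i (b - 1 - j), where b - 1 - j may be negative *)
Definition wrap_entry (i j : nat) : R :=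
  if (j < b)%N then entry i (b - 1 - j) else 0.

(* log n! is read off a table that account_steps tabulates once. *)
Definition log_fact (n : nat) : R := ln (n`!)%:R.

Definition init_weight (l : seq nat) : prog R :=
  let! inter := sumM (iota 0 (p - 1)) (fun j => sumM (iota 0 j) (fun i =>
    compute 6 (entry i j * (nth 0%N l i * nth 0%N l j)%:R / sigma ^+ 2))) in
  let! diag := sumM (iota 0 (p - 1)) (fun i =>
    compute 10 (entry i i * (nth 0%N l i * (nth 0%N l i - 1))%:R / (2 * sigma ^+ 2)
             - log_fact (nth 0%N l i))) in
  compute 1 (inter + diag).

Definition push (r : seq nat) (t : nat) : prog (seq nat) :=
  compute (size r).+1
    (if p == 1%N then [::]
     else if (size r < p - 1)%N then rcons r t
     else rcons (behead r) t).

Definition extend (q : nat) (states : dict R) (x : key) (new_states : dict R) :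
    prog (dict R) :=
  let m := x.1 in let r := x.2 in let L := size r in
  let! w := dict_get states x in
  let! acc := sumM (iota 0 L) (fun i =>
    compute 5 (entry q (q - L + i) * (nth 0%N r i)%:R)) in
  let! S1 := compute 1 (2 * acc) in
  foldM (fun t new =>
      let! delta := compute 12
        ((entry q q * (t * (t - 1))%:R + S1 * t%:R) / (2 * sigma ^+ 2)
         - log_fact t) in
      let! m' := compute 1 (m + t)%N in
      let! r' := push r t in
      let! old := dict_get new (m', r') in
      let! v := compute 5 (LSE (w + delta%:E)%E old) in
      dict_set new (m', r') v)
    (iota 0 (alpha - m).+1) new_states.

Definition step (q : nat) (states : dict R) : prog (dict R) :=
  let! new_states := foldM (extend q states) (keys states) [fmap]%fmap in
  let! _ := dict_free states in
  ret new_states.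

Definition collect (l : seq nat) (states : dict R) : prog (\bar R) :=
  foldM (fun x logSl =>
      let m := x.1 in let r := x.2 in let L := size r in
      let! _ := tick 1 in
      if m == alpha then
        let! logSlr := sumM (iota 0 (p - 1)) (fun i =>
          sumM (iota 0 (p - 1)) (fun j =>
            compute 10 (wrap_entry i j * (nth 0%N l i * nth 0%N r (L - 1 - j))%:R
                     / sigma ^+ 2))) in
        let! w := dict_get states x in
        compute 5 (LSE logSl (w + logSlr%:E)%E)
      else ret logSl)
    (keys states) -oo%E.

Definition tuple_sum (l : seq nat) : prog (\bar R) :=
  let! m := compute (size l) (sumn l) in
  let! w := init_weight l in
  let! states0 := dict_set [fmap]%fmap (m, l) w%:E in
  let! states := foldM step (iota (p - 1) (b - (p - 1))) states0 in
  let! logSl := collect l states in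
  let! _ := dict_free states in
  ret logSl.

(* Working storage: the table of log n! for n <= alpha, the band of G (its
   entries at circular distance < p), the tuples l, r, r' and finitely many
   scalars.  Moving to the next tuple l costs p. *)
Definition account_steps : prog (\bar R) :=
  let! _ := alloc alpha.+1 in
  let! _ := tick (3 * alpha.+1) in
  let! _ := alloc #|[pred x : 'I_b * 'I_b | (circ_dist x.1 x.2 < p)%N]| in
  let! _ := tick (4 * #|[pred x : 'I_b * 'I_b | (circ_dist x.1 x.2 < p)%N]|) in
  let! _ := alloc (3 * p + 32) in
  let! logS := foldM (fun l logS =>
      let! _ := tick p in
      let! logSl := tuple_sum l in
      compute 4 (LSE logS logSl))
    (tuples (p - 1) alpha) -oo%E in
  compute 12 (((alpha%:R - 1)^-1)%:E *
             (logS + (log_fact alpha)%:E - (alpha%:R * ln b%:R)%:E)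
           + (tau * alpha%:R / (2 * sigma ^+ 2))%:E)%E.

End Accountant.

(* The meter starts once the entries of G and tau are available. *)
Definition accountant (R : realType) (k b : nat) (C : 'M[R]_(k * b))
    (p alpha : nat) (sigma : R) : \bar R * meter :=
  run (account_steps (gram C) p alpha sigma).

(* Main.v *)
(* Each component of P_hat has density exp(<m_i, x> / s^2 - |m_i|^2 / 2s^2) with
   respect to Q_hat (s = sigma); this exponential has integral 1, so expanding the
   alpha-th power of the density of P_hat and completing the square gives V.

   For the algorithm, read a dictionary of log-weights as a positive linear
   functional on functions of a key.  One round of step (b) acts on these
   functions by a transfer operator, so S is obtained by iterating transfer
   operators on the final factor of step (c); unfolding the iteration, S is a sum
   over count vectors x with sum alpha of exp(E(x)), where E collects the
   interactions counted by the program.  Those with linear distance < p occur in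
   steps (a) and (b), those which wrap around the circle in step (c); the latter
   are counted in addition to the former only if b < 3(p - 1), and all terms are
   nonnegative.  The multinomial theorem turns the sum over count vectors back
   into a sum over tuples r.  Finally G <= G^(p) + tau entrywise costs the additive
   term in tau, and for banded matrices G^(p) = G and tau = 0. *)

From mathcomp Require Import all_boot all_order all_algebra.
From mathcomp Require Import all_classical all_reals all_analysis.
From mathcomp Require Import finmap measurable_realfun normal_distribution random_variable.
From mathcomp Require Import ring lra zify.
Require Import Defs.

Set Implicit Arguments.
Unset Strict Implicit.
Unset Printing Implicit Defensive.
Import Order.TTheory GRing.Theory Num.Theory.
Import numFieldNormedType.Exports.
Local Open Scope classical_set_scope.
Local Open Scope ring_scope.

(** * Gaussian mixtures *)

Section density.
Local Open Scope ereal_scope.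
Local Open Scope charge_scope.
Context d (T : measurableType d) (R : realType).
Variables (nu : {finite_measure set T -> \bar R})
  (mu : {sigma_finite_measure set T -> \bar R}) (g : T -> \bar R).
Hypotheses (mg : measurable_fun setT g)
  (nuE : forall A, measurable A -> nu A = \int[mu]_(x in A) g x).

Lemma density_dominates : nu `<< mu.
Proof.
apply/null_content_dominatesP => A mA muA0; rewrite nuE//.
by apply: null_set_integral => //; exact: measurable_funTS.
Qed.

(** Both functions have integral [nu A] over every measurable [A], which determines an integrable
    function almost everywhere. *)
Lemma density_Radon_Nikodym :
  ae_eq mu setT ('d (charge_of_finite_measure nu) '/d mu) g.
Proof.
have numu := density_dominates.
apply: integral_ae_eq => //; first exact: Radon_Nikodym_integrable.
move=> A _ mA; rewrite -nuE//; apply/esym.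
exact: (Radon_Nikodym_integral (nu := charge_of_finite_measure nu)).
Qed.

Lemma density_integral (f : T -> \bar R) :
  measurable_fun setT f -> (forall x, 0 <= f x) ->
  \int[nu]_x f x = \int[mu]_x (f x * g x).
Proof.
move=> mf f0; have numu := density_dominates.
rewrite -(Radon_Nikodym_SigmaFinite.change_of_variables numu)//.
have mRN : measurable_fun setT (Radon_Nikodym_SigmaFinite.f nu mu).
  exact: measurable_int (Radon_Nikodym_SigmaFinite.f_integrable numu).
apply: ae_eq_integral => //; try exact: emeasurable_funM.
apply: ae_eqe_mul2l.
apply: ae_eq_trans density_Radon_Nikodym.
exact: ae_eq_Radon_Nikodym_SigmaFinite.
Qed.

End density.

Section gaussian_density.
Context (R : realType) (sigma : R).
Hypothesis sigma0 : sigma != 0.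
Local Notation Rm := (measurableTypeR R).

Lemma normal_pdf_tilt (m x : R) :
  normal_pdf m sigma x =
  normal_pdf 0 sigma x * expR (m * x / sigma ^+ 2 - m ^+ 2 / (2 * sigma ^+ 2)).
Proof.
have pdfE a : normal_pdf a sigma x =
    normal_peak sigma * expR (- (x - a) ^+ 2 / (sigma ^+ 2 *+ 2)).
  by rewrite normal_pdfE.
rewrite !pdfE -[RHS]mulrA -[in RHS]expRD; congr (_ * expR _).
by rewrite -mulr_natl; field.
Qed.

Lemma integral_normal_prob (m : R) (f : Rm -> \bar R) :
  measurable_fun setT f -> (forall x, 0 <= f x)%E ->
  (\int[normal_prob m sigma]_x f x =
   \int[lebesgue_measure]_x (f x * (normal_pdf m sigma x)%:E))%E.
Proof.
move=> mf f0.
apply: (@density_integral _ _ _ (normal_prob m sigma) lebesgue_measure) => //.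
by apply/measurable_EFinP; exact: measurable_normal_pdf.
Qed.

Lemma integral_normal_prob_tilt (m : R) (f : Rm -> \bar R) :
  measurable_fun setT f -> (forall x, 0 <= f x)%E ->
  (\int[normal_prob m sigma]_x f x =
   \int[normal_prob 0 sigma]_x (f x *
     (expR (m * x / sigma ^+ 2 - m ^+ 2 / (2 * sigma ^+ 2)))%:E))%E.
Proof.
move=> mf f0; rewrite !integral_normal_prob//.
- apply: eq_integral => x _; rewrite normal_pdf_tilt -muleA -EFinM.
  by rewrite [X in (_ * X%:E)%E]mulrC.
- apply: emeasurable_funM => //; apply/measurable_EFinP.
  apply: measurableT_comp => //; apply: measurable_funB => //.
  by apply: measurable_funM => //; exact: measurable_funM.
- by move=> x; rewrite mule_ge0// lee_fin expR_ge0.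
Qed.

(** The log-density of N(mu, sigma^2 I) with respect to N(0, sigma^2 I). *)
Definition tilt n (mu x : n.-tuple R) : R :=
  \sum_(s < n) (tnth mu s * tnth x s / sigma ^+ 2
                - tnth mu s ^+ 2 / (2 * sigma ^+ 2)).

Lemma measurable_tilt n (mu : n.-tuple R) :
  measurable_fun [set: n.-tuple Rm] (fun x => tilt mu x).
Proof.
apply: measurable_sum => s; apply: measurable_funB => //.
apply: measurable_funM => //; apply: measurable_funM => //.
exact: measurable_tnth.
Qed.

Lemma tilt_cons n (mu : n.+1.-tuple R) (x : Rm * n.-tuple Rm) :
  tilt mu (tcons x) = thead mu * x.1 / sigma ^+ 2 - thead mu ^+ 2 / (2 * sigma ^+ 2)
    + tilt [tuple of behead mu] x.2.
Proof.
rewrite /tilt big_ord_recl; congr (_ + _); apply: eq_bigr => s _.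
by rewrite [in LHS](tuple_eta mu) !tnthS.
Qed.

Lemma integral_gaussianS n (mu : n.+1.-tuple R) (f : n.+1.-tuple Rm -> \bar R) :
  measurable_fun setT f -> (forall x, 0 <= f x)%E ->
  (\int[gaussian sigma mu]_x f x =
   \int[normal_prob (thead mu) sigma]_x
     \int[gaussian sigma [tuple of behead mu]]_y f (tcons (x, y)))%E.
Proof.
move=> mf f0.
transitivity (\int[normal_prob (thead mu) sigma \x
    gaussian sigma [tuple of behead mu]]_z (f \o @tcons R n) z)%E.
  exact: ge0_integral_distribution.
apply: (@fubini_tonelli1 _ _ _ _ _ _ _ (f \o @tcons R n)).
  exact: (measurableT_comp mf (@measurable_tcons R n)).
by move=> x; exact: f0.
Qed.

Lemma measurable_integral_gaussian n (mu : n.-tuple R)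
    (f : n.+1.-tuple Rm -> \bar R) :
  measurable_fun setT f -> (forall x, 0 <= f x)%E ->
  measurable_fun [set: Rm]
    (fun x => \int[gaussian sigma mu]_y f (tcons (x, y)))%E.
Proof.
move=> mf f0.
apply: (@measurable_fun_fubini_tonelli_F _ _ _ _ _ _ (f \o @tcons R n)).
  exact: (measurableT_comp mf (@measurable_tcons R n)).
by move=> x; exact: f0.
Qed.

(** Induction on the dimension: Tonelli splits off the first coordinate, where the one-dimensional
    change of density applies; the induction hypothesis supplies the factor of the other
    coordinates. *)
Lemma gaussian_tilt n (mu : n.-tuple R) (f : n.-tuple Rm -> \bar R) :
  measurable_fun setT f -> (forall x, 0 <= f x)%E ->
  (\int[gaussian sigma mu]_x f x =
   \int[gaussian sigma [tuple (0 : R)%R | s < n]]_x (f x * (expR (tilt mu x))%:E))%E.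
Proof.
elim: n mu f => [|n IH] mu f mf f0.
  apply: eq_integral => x _.
  by rewrite /tilt big_ord0 expR0 mule1.
have tilt0 x : (0 <= f x * (expR (tilt mu x))%:E)%E.
  by rewrite mule_ge0// lee_fin expR_ge0.
have mtilt : measurable_fun setT
    (fun x : n.+1.-tuple Rm => (f x * (expR (tilt mu x))%:E)%E).
  apply: emeasurable_funM => //; apply/measurable_EFinP.
  by apply: measurableT_comp => //; exact: measurable_tilt.
apply: etrans (integral_gaussianS mu mf f0) _.
apply/esym; apply: etrans (integral_gaussianS _ mtilt tilt0) _; apply/esym.
have -> : thead [tuple (0 : R) | _ < n.+1] = 0 by rewrite /thead tnth_mktuple.
have -> : [tuple of behead [tuple (0 : R) | _ < n.+1]] = [tuple 0 | _ < n].
  by apply: eq_from_tnth => i; rewrite tnth_behead !tnth_mktuple.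
rewrite integral_normal_prob_tilt; last 2 first.
- exact: measurable_integral_gaussian.
- by move=> x; exact: integral_ge0.
apply: eq_integral => x _.
have mfx : measurable_fun setT (fun y => f (tcons (x, y))).
  apply: (measurableT_comp mf); apply: (measurableT_comp (@measurable_tcons R n)).
  exact: pair1_measurable.
rewrite IH// muleC -ge0_integralZl ?lee_fin ?expR_ge0//; last 2 first.
- apply: emeasurable_funM => //; apply/measurable_EFinP.
  by apply: measurableT_comp => //; exact: measurable_tilt.
- by move=> y _; rewrite mule_ge0// lee_fin expR_ge0.
apply: eq_integral => y _.
by rewrite muleCA -EFinM -expRD tilt_cons.
Qed.

End gaussian_density.

(** Passing from [P] to [Q] contributes one more factor [g], so the power [a - 1] becomes [a]. The
    Radon-Nikodym derivative may be replaced by [g], to which it is equal [Q]-almost everywhere. *)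
Lemma renyi_density (R : realType) d (T : measurableType d)
    (P Q : {finite_measure set T -> \bar R}) (g : T -> R) (a : nat) :
  measurable_fun setT g -> (forall x, 0 <= g x) ->
  (forall A, measurable A -> P A = \int[Q]_(x in A) (g x)%:E)%E ->
  (0 < a)%N ->
  renyi a%:R P Q =
  (((a%:R - 1)^-1)%:E * lne (\int[Q]_x (g x ^+ a)%:E))%E.
Proof.
move=> mg g0 PE a0; rewrite /renyi; congr (_ * lne _)%E.
have mg' : measurable_fun setT (EFin \o g) by exact/measurable_EFinP.
have mRN : measurable_fun setT
    (Radon_Nikodym (charge_of_finite_measure P) Q).
  apply: measurable_int; apply: Radon_Nikodym_integrable.
  exact: density_dominates PE.
rewrite (density_integral mg' PE); last 2 first.
- exact: (measurableT_comp (measurable_poweR _)).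
- by move=> x; exact: poweR_ge0.
transitivity (\int[Q]_x (((EFin \o g) x) `^ (a%:R - 1) * (EFin \o g) x))%E.
  apply: ae_eq_integral => //.
  - apply: emeasurable_funM => //.
    exact: (measurableT_comp (measurable_poweR _)).
  - apply: emeasurable_funM => //.
    exact: (measurableT_comp (measurable_poweR _)).
  - exact: (ae_eq_comp2 (fun x y => poweR y (a%:R - 1) * (g x)%:E)%E
      (density_Radon_Nikodym mg' PE)).
apply: eq_integral => x _ /=.
rewrite -EFinM; congr _%:E.
have -> : a%:R - 1 = a.-1%:R :> R by rewrite -[in LHS](prednK a0) -natr1 addrK.
by rewrite powR_mulrn// -exprSr prednK.
Qed.

Section gaussian_mixture.
Context (R : realType) (sigma : R) (n b : nat) (m : 'I_b -> n.-tuple R).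
Hypothesis sigma0 : sigma != 0.
Local Notation Rm := (measurableTypeR R).
Local Notation Q := (gaussian sigma [tuple (0 : R) | s < n]).

Let g (x : n.-tuple Rm) : R := b%:R^-1 * \sum_(i < b) expR (tilt sigma (m i) x).

Lemma measurable_expR_tilt (mu : n.-tuple R) :
  measurable_fun [set: n.-tuple Rm] (fun x => expR (tilt sigma mu x)).
Proof. by apply: measurableT_comp => //; exact: measurable_tilt. Qed.

Let mg : measurable_fun setT g.
Proof.
apply: measurable_funM => //; apply: measurable_sum => i.
exact: measurable_expR_tilt.
Qed.

Let g0 x : 0 <= g x.
Proof.
by rewrite mulr_ge0 ?invr_ge0// sumr_ge0// => i _; exact: expR_ge0.
Qed.

Lemma gaussian_setE (mu : n.-tuple R) (A : set (n.-tuple Rm)) : measurable A ->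
  gaussian sigma mu A = (\int[Q]_(x in A) (expR (tilt sigma mu x))%:E)%E.
Proof.
move=> mA; rewrite -[A in LHS]setIT -integral_indic// gaussian_tilt//; last first.
  by apply/measurable_EFinP; exact: measurable_indic.
rewrite [RHS]integral_mkcond; apply: eq_integral => x _.
by rewrite epatch_indic muleC.
Qed.

(** The integrand is a probability density, that of the Gaussian with mean [mu]. *)
Lemma gaussian_mgf (mu : n.-tuple R) :
  (\int[Q]_x (expR (tilt sigma mu x))%:E = 1)%E.
Proof.
by rewrite -gaussian_setE// probability_setT.
Qed.

Let PE A : measurable A ->
  (unif_mixture (fun i => gaussian sigma (m i)) A = \int[Q]_(x in A) (g x)%:E)%E.
Proof.
move=> mA; rewrite /unif_mixture /g.
under eq_integral do rewrite EFinM -sumEFin.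
rewrite ge0_integralZl ?lee_fin ?invr_ge0 ?exprn_ge0//=; last 2 first.
- apply: emeasurable_sum => i; apply/measurable_funTS/measurable_EFinP.
  exact: measurable_expR_tilt.
- by move=> x _; apply: sume_ge0 => i _; rewrite lee_fin expR_ge0.
congr (_ * _)%E; rewrite ge0_integral_sum//; last first.
  move=> i; apply/measurable_funTS/measurable_EFinP.
  exact: measurable_expR_tilt.
by apply: eq_bigr => i _; exact: gaussian_setE.
Qed.

(** Completing the square: the squared norm of the summed mean exceeds the sum of the squared norms
    by the cross terms, which do not depend on [x]. *)
Lemma sum_tilt a (r : 'I_a -> 'I_b) x :
  \sum_(j < a) tilt sigma (m (r j)) x =
  tilt sigma [tuple \sum_(j < a) tnth (m (r j)) s | s < n] x +
  \sum_(j1 < a) \sum_(j2 < a | j1 != j2)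
    (\sum_(s < n) tnth (m (r j1)) s * tnth (m (r j2)) s) / (2 * sigma ^+ 2).
Proof.
have -> : \sum_(j1 < a) \sum_(j2 < a | j1 != j2)
    (\sum_(s < n) tnth (m (r j1)) s * tnth (m (r j2)) s) / (2 * sigma ^+ 2) =
  \sum_(s < n) ((\sum_(j < a) tnth (m (r j)) s) ^+ 2
     - \sum_(j < a) tnth (m (r j)) s ^+ 2) / (2 * sigma ^+ 2).
  set c := 2 * sigma ^+ 2.
  pose F j1 j2 := (\sum_(s < n) tnth (m (r j1)) s * tnth (m (r j2)) s) / c.
  have D j1 : \sum_(j2 < a | j1 != j2) F j1 j2 = \sum_(j2 < a) F j1 j2 - F j1 j1.
    rewrite [in RHS](bigD1 j1)//= addrAC subrr add0r.
    by apply: eq_bigl => j2; rewrite eq_sym.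
  under eq_bigr do rewrite -/(F _ _) D.
  rewrite sumrB; under [RHS]eq_bigr do rewrite mulrBl.
  rewrite sumrB; congr (_ - _).
    under [RHS]eq_bigr do rewrite expr2 big_distrlr/= mulr_suml.
    rewrite [RHS]exchange_big/=; apply: eq_bigr => j1 _.
    under [RHS]eq_bigr do rewrite mulr_suml.
    rewrite [RHS]exchange_big/=; apply: eq_bigr => j2 _.
    by rewrite /F mulr_suml.
  under [RHS]eq_bigr do rewrite mulr_suml.
  rewrite [RHS]exchange_big/=; apply: eq_bigr => j1 _.
  by rewrite /F mulr_suml; apply: eq_bigr => s _; rewrite expr2.
rewrite /tilt exchange_big -big_split/=; apply: eq_bigr => s _.
rewrite tnth_mktuple sumrB -!mulr_suml.
by field.
Qed.

(** The power of the density [g] expands into one term per tuple [r]; by [sum_tilt] each is a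
    constant times a Gaussian density of integral 1. *)
Lemma renyi_gaussian_mixture a : (0 < a)%N ->
  renyi a%:R (unif_mixture (fun i => gaussian sigma (m i))) Q =
  (((a%:R - 1)^-1)%:E * lne ((b%:R ^- a * \sum_(r : {ffun 'I_a -> 'I_b})
    expR (\sum_(j1 < a) \sum_(j2 < a | j1 != j2)
      (\sum_(s < n) tnth (m (r j1)) s * tnth (m (r j2)) s) / (2 * sigma ^+ 2)))%:E))%E.
Proof.
move=> a0; rewrite (renyi_density mg g0 PE a0); congr (_ * lne _)%E.
have gE x : g x ^+ a = b%:R ^- a * \sum_(r : {ffun 'I_a -> 'I_b})
    expR (\sum_(j < a) tilt sigma (m (r j)) x).
  rewrite exprMn exprVn; congr (_ * _).
  rewrite -[in LHS](card_ord a) -prodr_const bigA_distr_bigA/=.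
  by apply: eq_bigr => r _; rewrite expR_sum.
under eq_integral do rewrite gE EFinM -sumEFin.
have mr (r : {ffun 'I_a -> 'I_b}) : measurable_fun [set: n.-tuple Rm]
    (fun x => (expR (\sum_(j < a) tilt sigma (m (r j)) x))%:E).
  apply/measurable_EFinP/measurableT_comp => //.
  by apply: measurable_sum => j; exact: measurable_tilt.
rewrite ge0_integralZl ?lee_fin ?invr_ge0 ?exprn_ge0//=; last 2 first.
- exact: emeasurable_sum.
- by move=> x _; apply: sume_ge0 => i _; rewrite lee_fin expR_ge0.
rewrite ge0_integral_sum//.
rewrite EFinM -sumEFin; congr (_ * _)%E; apply: eq_bigr => r _.
under eq_integral do rewrite sum_tilt expRD EFinM.
rewrite ge0_integralZr ?lee_fin ?expR_ge0//=.
  by rewrite gaussian_mgf mul1e.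
by apply/measurable_EFinP; exact: measurable_expR_tilt.
Qed.

End gaussian_mixture.

Lemma sum_expR_gt0 (R : realType) (a b : nat) (F : {ffun 'I_a -> 'I_b} -> R) :
  (0 < b)%N -> 0 < \sum_(r : {ffun 'I_a -> 'I_b}) expR (F r).
Proof.
move=> b0; rewrite (bigD1 [ffun=> Ordinal b0])//=.
by rewrite ltr_wpDr ?expR_gt0// sumr_ge0// => r _; exact: expR_ge0.
Qed.

Lemma renyi_P_hat (R : realType) (k b a : nat) (sigma : R) (C : 'M[R]_(k * b)) :
  sigma != 0 -> (0 < b)%N -> (1 < a)%N ->
  renyi a%:R (P_hat sigma C) (Q_hat k b sigma) = (V_alpha sigma a C)%:E.
Proof.
move=> sigma0 b0 a1; rewrite /P_hat /Q_hat renyi_gaussian_mixture// ?(ltnW a1)//.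
set S := (X in (lne (_ * X)%:E)%E).
have -> : S = \sum_(r : {ffun 'I_a -> 'I_b})
    expR (\sum_(j1 < a) \sum_(j2 < a | j1 != j2)
            gram C (r j1) (r j2) / (2 * sigma ^+ 2)).
  apply: eq_bigr => r _; congr expR; apply: eq_bigr => j1 _.
  apply: eq_bigr => j2 _; rewrite mxE; congr (_ / _).
  by apply: eq_bigr => s _; rewrite !tnth_mktuple.
rewrite /V_alpha; set S' := \sum_(r : _) _.
have S0 : 0 < S' by exact: sum_expR_gt0.
have bR : 0 < b%:R :> R by rewrite ltr0n.
rewrite lne_EFin ?mulr_gt0 ?invr_gt0 ?exprn_gt0// -EFinM; congr _%:E.
rewrite lnM ?posrE ?invr_gt0 ?exprn_gt0// lnV ?posrE ?exprn_gt0// lnXn//.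
have a1' : a%:R - 1 != 0 :> R.
  by rewrite subr_eq0 pnatr_eq1 gtn_eqF.
by rewrite -mulr_natl; field.
Qed.

(** * Cost and value of the program *)

Section metered_programs.
Local Open Scope nat_scope.

(* Started with w words in use, x returns a result satisfying Q within t time
   units, leaves w' (result) words in use and never uses more than h words. *)
Definition triple A (x : prog A) (w t h : nat) (Q : A -> Prop) (w' : A -> nat) :=
  forall c, live c = w ->
    [/\ Q (x c).1, time (x c).2 <= time c + t, live (x c).2 = w' (x c).1
      & peak (x c).2 <= maxn (peak c) h].

(** For arithmetic, loops over sums and dictionary reads, whose storage is unchanged and whose
    result is a known value. *)
Definition pure_at A (x : prog A) (v : A) (t : nat) :=
  forall c, exists2 t', t' <= t & x c = (v, Meter (time c + t') (live c) (peak c)).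

Lemma triple_bind (A B : Type) (x : prog A) (f : A -> prog B) w t1 t2 h P w1 (Q : B -> Prop) w2 :
  triple x w t1 h P w1 ->
  (forall a, P a -> triple (f a) (w1 a) t2 h Q w2) ->
  triple (bind x f) w (t1 + t2) h Q w2.
Proof.
move=> Hx Hf c cw; rewrite /bind; have [+ + + +] := Hx c cw.
case: (x c) => a c1 /= Pa T1 L1 P1.
have [Qb T2 L2 P2] := Hf a Pa c1 L1.
split=> //; first by rewrite addnA (leq_trans T2)// leq_add2r.
by rewrite (leq_trans P2)// geq_max P1 leq_maxr.
Qed.

Lemma triple_weaken (A : Type) (x : prog A) w t t' h h' (Q Q' : A -> Prop) w' w'' :
  triple x w t h Q w' -> t <= t' -> h <= h' -> (forall a, Q a -> Q' a) ->
  (forall a, Q a -> w' a = w'' a) -> triple x w t' h' Q' w''.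
Proof.
move=> Hx tt hh QQ ww c cw; have [Qa T L P] := Hx c cw; split.
- exact: QQ.
- by rewrite (leq_trans T)// leq_add2l.
- by rewrite L ww.
- by rewrite (leq_trans P)// geq_max leq_maxl (leq_trans hh) ?leq_maxr.
Qed.

Lemma triple_ret (A : Type) (a : A) w t h (Q : A -> Prop) w' :
  Q a -> w' a = w -> triple (ret a) w t h Q w'.
Proof.
by move=> Qa wa c cw; split=> //=; rewrite ?leq_addr ?leq_maxl// wa.
Qed.

Lemma triple_pure (A : Type) (x : prog A) v w t h : pure_at x v t ->
  triple x w t h (eq^~ v) (fun=> w).
Proof.
by move=> Hx c cw; have [t' tt ->] := Hx c; split=> //=; rewrite ?leq_add2l ?leq_maxl.
Qed.

Lemma triple_pure_bind (A B : Type) (x : prog A) (f : A -> prog B) v w t1 t2 h Q w2 :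
  pure_at x v t1 -> triple (f v) w t2 h Q w2 ->
  triple (bind x f) w (t1 + t2) h Q w2.
Proof.
by move=> Hx Hf; apply: (triple_bind (triple_pure _ Hx)) => _ ->.
Qed.

Lemma triple_alloc (B : Type) (f : unit -> prog B) n w t h Q w2 :
  w + n <= h -> triple (f tt) (w + n) t h Q w2 ->
  triple (bind (alloc n) f) w t h Q w2.
Proof.
move=> wh Hf c cw; rewrite /bind/=.
have [Qb T L P] := Hf (Meter (time c) (live c + n) (maxn (peak c) (live c + n)))
  (f_equal (addn^~ n) cw).
split=> //; rewrite (leq_trans P)//= -maxnA geq_max leq_maxl/= geq_max leq_maxr andbT.
by rewrite cw (leq_trans wh)// leq_maxr.
Qed.

Lemma triple_release (B : Type) (f : unit -> prog B) n w t h Q w2 :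
  triple (f tt) (w - n) t h Q w2 -> triple (bind (release n) f) w t h Q w2.
Proof. by move=> Hf c cw; apply: Hf => /=; rewrite cw. Qed.

(** The invariant speaks of the processed prefix, so it can state a partial sum; the splitting of
    [s] tells the step that [a] occurs in [s]. The extra time unit is the loop overhead. *)
Lemma triple_foldM (A B : Type) (f : A -> B -> prog B) (s : seq A) (b0 : B) (w : B -> nat) t h
    (Inv : seq A -> B -> Prop) :
  Inv [::] b0 ->
  (forall s1 a s2 b, s = s1 ++ a :: s2 -> Inv s1 b ->
     triple (f a b) (w b) t h (Inv (rcons s1 a)) w) ->
  triple (foldM f s b0) (w b0) (size s * t.+1) h (Inv s) w.
Proof.
move=> I0 step.
suff H s1 s2 b : s = s1 ++ s2 -> Inv s1 b ->
    triple (foldM f s2 b) (w b) (size s2 * t.+1) h (Inv s) w.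
  exact: (H [::]).
elim: s2 s1 b => [|a s2 IH] s1 b es Ib /=.
  by apply: triple_ret => //; rewrite es cats0.
rewrite [X in triple _ _ X](_ : _ = 1 + (t + size s2 * t.+1)); last by rewrite mulSn.
apply: triple_pure_bind; first by move=> c; exists 1; rewrite ?leqnn.
apply: (triple_bind (step s1 a s2 b es Ib)) => b' Ib'.
by apply: IH Ib'; rewrite cat_rcons.
Qed.

Lemma pure_at_compute (A : Type) n (a : A) : pure_at (compute n a) a n.
Proof. by move=> c; exists n. Qed.

Lemma pure_at_bind (A B : Type) (x : prog A) (f : A -> prog B) v u t1 t2 :
  pure_at x v t1 -> pure_at (f v) u t2 -> pure_at (bind x f) u (t1 + t2).
Proof.
move=> Hx Hf c; have [s1 st1 E1] := Hx c; rewrite /bind E1.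
have [s2 st2 ->] := Hf (Meter (time c + s1) (live c) (peak c)).
by exists (s1 + s2); rewrite ?leq_add//= addnA.
Qed.

Lemma pure_at_weaken (A : Type) (x : prog A) v v' t t' :
  pure_at x v t -> v = v' -> t <= t' -> pure_at x v' t'.
Proof.
by move=> Hx <- tt c; have [s st ->] := Hx c; exists s => //; exact: leq_trans tt.
Qed.

Lemma pure_at_sumM (R : realType) (I : eqType) (s : seq I) (F : I -> prog R)
    (v : I -> R) t :
  (forall i, i \in s -> pure_at (F i) (v i) t) ->
  pure_at (sumM s F) (\sum_(i <- s) v i)%R (size s * t.+2).
Proof.
move=> HF; rewrite /sumM.
(* The induction needs an arbitrary initial accumulator. Each summand costs [t], one unit of loop
   overhead and one addition. *)
suff H a : pure_at (foldM (fun i acc => let! x := F i in compute 1 (acc + x)%R) s a)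
    (a + \sum_(i <- s) v i)%R (size s * t.+2) by have := H 0%R; rewrite add0r.
elim: s a HF => [|i s IH] a HF /=.
  by rewrite big_nil addr0 => c; exists 0; rewrite ?addn0//; case: c.
rewrite big_cons addrA.
apply: (@pure_at_weaken _ _ _ _ (1 + (t + 1 + size s * t.+2))) => //; last by lia.
apply: pure_at_bind; first by move=> c; exists 1.
apply: pure_at_bind.
  apply: pure_at_bind; first by apply: HF; rewrite inE eqxx.
  exact: pure_at_compute.
by apply: IH => j js; apply: HF; rewrite inE js orbT.
Qed.

End metered_programs.

Lemma tuplesS n s :
  tuples n.+1 s = [seq t :: l | t <- iota 0 s.+1, l <- tuples n (s - t)].
Proof. by []. Qed.

Lemma mem_tuples n s (l : seq nat) : (l \in tuples n s) = (size l == n) && (sumn l <= s)%N.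
Proof.
elim: n s l => [|n IH] s l; first by rewrite /= inE; case: l.
rewrite tuplesS.
apply/allpairsPdep/andP => [[t [l' [ts l's ->]]]|[]].
  move: l's ts; rewrite IH mem_iota/= => /andP[/eqP -> ls ts].
  by split=> //; lia.
case: l => [//|t l] /eqP[sl] ls; rewrite /= in ls; exists t, l.
split=> //; first by rewrite mem_iota; lia.
by rewrite IH sl eqxx/=; lia.
Qed.

Lemma size_tuples n s : size (tuples n s) = 'C(s + n, n).
Proof.
elim: n s => [|n IH] s; first by rewrite bin0.
rewrite tuplesS size_allpairs_dep.
have -> : [seq size (tuples n (s - t)) | t <- iota 0 s.+1] =
    [seq 'C(s - t + n, n) | t <- iota 0 s.+1] by apply: eq_map => t; exact: IH.
rewrite sumnE big_map.
(* Hockey-stick identity: the term [t = 0] and the sum for the smaller [s] combine by Pascal's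
   rule. *)
elim: s => [|s IHs]; first by rewrite big_seq1 subn0 add0n !binn.
rewrite -[iota 0 s.+2]/(0%N :: iota (1 + 0) s.+1) iotaDl big_cons big_map.
rewrite subn0 addSn addnS binS addnC; congr (_ + _)%N.
by rewrite addSnnS -IHs.
Qed.

(** * Dictionaries of log-weights as positive functionals *)

Section dictionary.
Context (R : realType).
Implicit Types (s : dict R) (phi : key -> R).

Definition words s := (\sum_(x <- keys s) (key_size x).+1)%N.

Definition weight s (x : key) : \bar R := expeR (odflt -oo%E s.[? x]%fmap).

Definition mass s phi : \bar R := (\sum_(x <- keys s) weight s x * (phi x)%:E)%E.

Lemma words_set s x v :
  words s.[x <- v]%fmap =
  (words s + if x \in domf s then 0 else (key_size x).+1)%N.
Proof.
rewrite /words /keys; case: ifPn => xs.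
  by rewrite addn0 dom_setf mem_fset1U.
by rewrite dom_setf big_fsetU1//= addnC.
Qed.

(** An absent key has weight exp(-oo) = 0. Adding it to the index set lets an update treat old and
    new keys alike. *)
Lemma mass_dom s x phi :
  mass s phi = (\sum_(y <- (x |` domf s)%fset) weight s y * (phi y)%:E)%E.
Proof.
rewrite /mass /keys; case: (boolP (x \in domf s)) => xs.
  by rewrite mem_fset1U.
by rewrite big_fsetU1//= /weight not_fnd//= mul0e add0e.
Qed.

Lemma expeR_LSE (u v : \bar R) : expeR (LSE u v) = (expeR u + expeR v)%E.
Proof. by apply/eqP; rewrite lneK_eq adde_ge0 ?expeR_ge0. Qed.

(** Through the exponential, an LSE update becomes the addition of a point mass at [x];
    nonnegativity of [phi] permits distributing in the extended reals. *)
Lemma mass_set s x v phi : (forall y, 0 <= phi y) ->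
  mass s.[x <- LSE v (odflt -oo%E s.[? x]%fmap)]%fmap phi =
  (mass s phi + expeR v * (phi x)%:E)%E.
Proof.
move=> phi0.
rewrite (mass_dom s x) /mass /keys dom_setf.
rewrite (big_fsetD1 x) ?fset1U1//= [in RHS](big_fsetD1 x) ?fset1U1//=.
rewrite [RHS]addeC addeA; congr (_ + _)%E.
  by rewrite /weight fnd_set eqxx/= expeR_LSE ge0_muleDl ?expeR_ge0.
by apply: eq_big_seq => y; rewrite !inE => /andP[/negbTE yx _]; rewrite /weight fnd_set yx.
Qed.

Lemma mass0 phi : mass [fmap]%fmap phi = 0%E.
Proof. by rewrite /mass /keys big_seq_fset0. Qed.

Lemma words0 : words [fmap]%fmap = 0%N.
Proof. by rewrite /words /keys big_seq_fset0. Qed.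

End dictionary.

(** * Cost and value of each procedure of the accountant *)

Section programs.
Context (R : realType) (b : nat) (G : 'M[R]_b) (p alpha : nat) (sigma : R).
Hypothesis p0 : (0 < p)%N.
Implicit Types (s : dict R) (phi : key -> R).

Let B := 'C(alpha + p, p).

(** The loop invariant on keys: suffixes always have full length, and the bounds on the partial sum
    limit the number of keys. *)
Definition good_keys s := forall x : key, x \in domf s ->
  size x.2 = (p - 1)%N /\ (sumn x.2 <= x.1 <= alpha)%N.

(** Replacing [m] by the part of it not contained in the suffix maps keys injectively to sequences
    of length [p] with sum at most [alpha]. *)
Lemma good_keys_card s : good_keys s -> (size (keys s) <= B)%N.
Proof.
move=> gs; rewrite /B -size_tuples.
rewrite -(size_map (fun x : key => (x.1 - sumn x.2)%N :: x.2)).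
apply: uniq_leq_size.
  rewrite map_inj_in_uniq ?fset_uniq// => -[m r] [m' r'] mr mr' /= [mm rr].
  by move: (gs _ mr) (gs _ mr') mm => /= [_] + [_]; rewrite rr => *; congr (_, _); lia.
move=> _ /mapP[[m r] mr ->]; rewrite mem_tuples/=.
by have [/= -> ?] := gs _ mr; lia.
Qed.

Lemma good_keys_words s : good_keys s -> (words s <= B * p.+1)%N.
Proof.
move=> gs; rewrite /words.
rewrite (eq_big_seq (fun=> p.+1)); last first.
  by move=> x xs; rewrite /key_size (gs x xs).1; lia.
by rewrite big_const_seq count_predT iter_addn_0 mulnC leq_mul2r good_keys_card// orbT.
Qed.

Definition push_val (r : seq nat) (t : nat) : seq nat :=
  if p == 1%N then [::]
  else if (size r < p - 1)%N then rcons r t else rcons (behead r) t.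

Definition delta (q : nat) (r : seq nat) (t : nat) : R :=
  (entry G p q q * (t * (t - 1))%:R
   + 2 * (\sum_(i <- iota 0 (size r)) entry G p q (q - size r + i) * (nth 0%N r i)%:R)
     * t%:R) / (2 * sigma ^+ 2) - log_fact R t.

(* dual to one round of step (b): see triple_step *)
Definition transfer (q : nat) phi (x : key) : R :=
  \sum_(t <- iota 0 (alpha - x.1).+1)
    expR (delta q x.2 t) * phi ((x.1 + t)%N, push_val x.2 t).

Definition wrap_exponent (l r : seq nat) : R :=
  \sum_(i <- iota 0 (p - 1)) \sum_(j <- iota 0 (p - 1))
    wrap_entry G p i j * (nth 0%N l i * nth 0%N r (size r - 1 - j))%:R / sigma ^+ 2.

Definition closing (l : seq nat) (x : key) : R :=
  if x.1 == alpha then expR (wrap_exponent l x.2) else 0.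

Definition init_exponent (l : seq nat) : R :=
  \sum_(j <- iota 0 (p - 1)) (\sum_(i <- iota 0 j)
    entry G p i j * (nth 0%N l i * nth 0%N l j)%:R / sigma ^+ 2)
  + \sum_(i <- iota 0 (p - 1))
    (entry G p i i * (nth 0%N l i * (nth 0%N l i - 1))%:R / (2 * sigma ^+ 2)
     - log_fact R (nth 0%N l i)).

Lemma transfer_ge0 q phi : (forall x, 0 <= phi x) -> forall x, 0 <= transfer q phi x.
Proof. by move=> phi0 x; apply: sumr_ge0 => t _; rewrite mulr_ge0 ?expR_ge0. Qed.

Lemma foldr_transfer_ge0 qs phi : (forall x, 0 <= phi x) ->
  forall x, 0 <= foldr transfer phi qs x.
Proof. by move=> phi0; elim: qs => //= q qs IH x; exact: transfer_ge0. Qed.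

Lemma closing_ge0 l x : 0 <= closing l x.
Proof. by rewrite /closing; case: ifP => // _; exact: expR_ge0. Qed.

Lemma push_val_good r t : size r = (p - 1)%N ->
  size (push_val r t) = (p - 1)%N /\ (sumn (push_val r t) <= sumn r + t)%N.
Proof.
rewrite /push_val; case: eqVneq => [->//|p1] sr; rewrite sr ltnn size_rcons size_behead.
split; first by lia.
by rewrite sumn_rcons; case: r sr => [|? ?] /= _; lia.
Qed.

Lemma pure_at_init_weight l :
  pure_at (init_weight G p sigma l) (init_exponent l) (23 * (p * p)).
Proof.
rewrite /init_weight /init_exponent.
have H1 : pure_at (sumM (iota 0 (p - 1)) (fun j => sumM (iota 0 j) (fun i =>
    compute 6 (entry G p i j * (nth 0%N l i * nth 0%N l j)%:R / sigma ^+ 2))))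
    (\sum_(j <- iota 0 (p - 1)) (\sum_(i <- iota 0 j)
      entry G p i j * (nth 0%N l i * nth 0%N l j)%:R / sigma ^+ 2))
    (size (iota 0 (p - 1)) * (p * 8).+2).
  apply: pure_at_sumM => j; rewrite mem_iota => /andP[_ jp].
  apply: (@pure_at_weaken _ _ _ _ (size (iota 0 j) * 8)) => //.
    by apply: pure_at_sumM => i _; exact: pure_at_compute.
  by rewrite size_iota; lia.
(* The double loop, the diagonal loop and the final addition; lower-order terms are absorbed into
   the coefficient of [p * p]. *)
apply: (@pure_at_weaken _ _ _ _
  ((p - 1) * (p * 8).+2 + ((p - 1) * 12 + 1))) => //; last by nia.
rewrite size_iota in H1.
apply: (pure_at_bind H1).
have H2 : pure_at (sumM (iota 0 (p - 1)) (fun i => compute 10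
    (entry G p i i * (nth 0%N l i * (nth 0%N l i - 1))%:R / (2 * sigma ^+ 2)
     - log_fact R (nth 0%N l i))))
    (\sum_(i <- iota 0 (p - 1))
    (entry G p i i * (nth 0%N l i * (nth 0%N l i - 1))%:R / (2 * sigma ^+ 2)
     - log_fact R (nth 0%N l i))) (size (iota 0 (p - 1)) * 12).
  by apply: pure_at_sumM => i _; exact: pure_at_compute.
rewrite size_iota in H2.
by apply: (pure_at_bind H2); exact: pure_at_compute.
Qed.

Lemma triple_dict_set s (x : key) v (w h : nat) :
  (w + words s.[x <- v]%fmap <= h)%N ->
  triple (dict_set s x v) (w + words s) (key_size x).+1 h
    (eq^~ s.[x <- v]%fmap) (fun s' => (w + words s')%N).
Proof.
move=> wh; rewrite -[X in triple _ _ X](addn0 (key_size x).+1).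
apply: triple_pure_bind; first exact: pure_at_compute.
move: wh; rewrite words_set addnA => wh.
apply: triple_alloc => //; apply: triple_ret => //.
by rewrite words_set addnA.
Qed.

Lemma pure_at_push r t : size r = (p - 1)%N ->
  pure_at (push p r t) (push_val r t) p.
Proof.
by move=> sr; apply: (pure_at_weaken (pure_at_compute _ _)) => //; lia.
Qed.

Lemma pure_at_dict_get s (x : key) : size x.2 = (p - 1)%N ->
  pure_at (dict_get s x) (odflt -oo%E s.[? x]%fmap) p.
Proof.
move=> sx; apply: (pure_at_weaken (pure_at_compute _ _)) => //.
by rewrite /key_size; lia.
Qed.

(** Each [t] adds one point mass to the new dictionary, so the key [x] contributes its weight times
    [transfer q phi x] in total. *)
Lemma triple_extend q s (x : key) new (w h : nat) :
  good_keys s -> x \in domf s -> good_keys new -> (w + B * p.+1 <= h)%N ->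
  triple (extend G p alpha sigma q s x new) (w + words new)
    (alpha.+1 * (31 * p)) h
    (fun s' => good_keys s' /\ forall phi, (forall y, 0 <= phi y) ->
       mass s' phi = (mass new phi + weight s x * (transfer q phi x)%:E)%E)
    (fun s' => (w + words s')%N).
Proof.
move=> gs xs gnew wh; have [sx /andP[mx ma]] := gs x xs.
have accP : pure_at (sumM (iota 0 (size x.2)) (fun i =>
    compute 5 (entry G p q (q - size x.2 + i) * (nth 0%N x.2 i)%:R)))
    (\sum_(i <- iota 0 (size x.2))
      entry G p q (q - size x.2 + i) * (nth 0%N x.2 i)%:R)
    (size (iota 0 (size x.2)) * 7).
  by apply: pure_at_sumM => i _; exact: pure_at_compute.
rewrite size_iota in accP.
apply: (@triple_weaken _ _ _ (p + (size x.2 * 7 +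
  (1 + (alpha - x.1).+1 * (19 + 3 * p).+1)))%N _ h _ _ _
  (fun s' => (w + words s')%N)); first last.
- by [].
- by move=> s'; exact: id.
- by [].
- rewrite sx; nia.
apply: triple_pure_bind; first exact: pure_at_dict_get.
apply: (triple_pure_bind accP).
apply: triple_pure_bind; first exact: pure_at_compute.
rewrite -[X in (X * _)%N](size_iota 0).
set body := (X in foldM X).
apply: (@triple_foldM _ _ body (iota 0 (alpha - x.1).+1) new
  (fun acc => (w + words acc)%N) _ h (fun pre acc => good_keys acc /\
    forall phi, (forall y, 0 <= phi y) -> mass acc phi = (mass new phi +
      weight s x * (\sum_(t <- pre)
        expR (delta q x.2 t) * phi ((x.1 + t)%N, push_val x.2 t))%:E)%E)).
  by split=> // phi _; rewrite big_nil mule0 adde0.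
move=> pre t post acc et [gacc macc].
have tle : (t <= alpha - x.1)%N.
  have : t \in iota 0 (alpha - x.1).+1 by rewrite et mem_cat inE eqxx orbT.
  by rewrite mem_iota.
rewrite /body; set y := ((x.1 + t)%N, push_val x.2 t).
have [sy sumy] := push_val_good t sx.
(* The costs of the increment, the new partial sum, the new suffix, the lookup, the LSE and the
   insertion. *)
have tE : (19 + 3 * p = 12 + (1 + (p + (p + (5 + p.+1)))))%N by lia.
rewrite tE.
apply: triple_pure_bind; first exact: pure_at_compute.
apply: triple_pure_bind; first exact: pure_at_compute.
apply: triple_pure_bind; first exact: pure_at_push.
apply: triple_pure_bind; first exact: (@pure_at_dict_get _ y).
apply: triple_pure_bind; first exact: pure_at_compute.
set v := LSE _ _.
have gset : good_keys acc.[y <- v]%fmap.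
  move=> z; rewrite dom_setf !inE => /predU1P[->|/gacc//]/=.
  split=> //; rewrite /y/=; apply/andP; split; lia.
have wset : (w + words acc.[y <- v]%fmap <= h)%N.
  by rewrite (leq_trans _ wh)// leq_add2l good_keys_words.
apply: (triple_weaken (triple_dict_set wset)) => //.
  by rewrite /key_size sy; lia.
move=> _ ->; split=> // phi phi0.
rewrite mass_set// macc// -addeA; congr (_ + _)%E.
rewrite -cats1 big_cat/= big_seq1 [in RHS]EFinD [in RHS]ge0_muleDr ?lee_fin//; last 2 first.
- by apply: sumr_ge0 => u _; rewrite mulr_ge0 ?expR_ge0.
- by rewrite mulr_ge0 ?expR_ge0.
by congr (_ + _)%E; rewrite expeRD EFinM muleA.
Qed.

(** Old and new dictionaries coexist during a round, hence a full dictionary of storage beyond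
    [words s]; the old one is freed at the end. *)
Lemma triple_step q s (w h : nat) :
  good_keys s -> (w + words s + B * p.+1 <= h)%N ->
  triple (step G p alpha sigma q s) (w + words s) (B * (alpha.+1 * (32 * p))) h
    (fun s' => good_keys s' /\ forall phi, (forall y, 0 <= phi y) ->
       mass s' phi = mass s (transfer q phi))
    (fun s' => (w + words s')%N).
Proof.
move=> gs wh; rewrite -[X in triple _ _ X](addn0 (B * _)).
pose Inv (pre : seq key) (acc : dict R) := good_keys acc /\
  forall phi, (forall y, 0 <= phi y) ->
    mass acc phi = (\sum_(x <- pre) weight s x * (transfer q phi x)%:E)%E.
apply: (@triple_bind _ _ _ _ _ _ _ _ (Inv (keys s))
   (fun s' => w + words s + words s')%N).
  rewrite -[X in triple _ X](addn0 (w + words s)) -[X in (_ + X)%N](@words0 R).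
  apply: (@triple_weaken _ _ _
    (size (keys s) * (alpha.+1 * (31 * p)).+1)%N _ h _ (Inv (keys s)) _
    (fun s' => w + words s + words s')%N) => //; last first.
    apply: leq_mul; first exact: good_keys_card.
    by nia.
  apply: (@triple_foldM _ _ (extend G p alpha sigma q s) (keys s) [fmap]%fmap
    (fun s' => w + words s + words s')%N _ h Inv).
    split=> [x|phi _]; last by rewrite mass0 big_nil.
    by rewrite domf0 inE.
  move=> pre x post acc es [gacc macc].
  have xs : x \in domf s by rewrite -[_ \in _]/(x \in keys s) es mem_cat inE eqxx orbT.
  apply: (triple_weaken (triple_extend q gs xs gacc wh)) => // s' [gs' ms'].
  split=> // phi phi0; rewrite ms'// macc// -cats1 big_cat/= big_seq1.
  by [].
move=> s' [gs' ms'].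
apply: triple_release; apply: triple_ret; last by rewrite -/(words s); lia.
by split=> // phi phi0; exact: ms'.
Qed.

(** By duality the last round acts on [phi] first, which is the nesting order of [foldr]. *)
Lemma triple_steps qs s (w h : nat) :
  good_keys s -> (w + B * p.+1 + B * p.+1 <= h)%N ->
  triple (foldM (step G p alpha sigma) qs s) (w + words s)
    (size qs * (B * (alpha.+1 * (32 * p))).+1) h
    (fun s' => good_keys s' /\ forall phi, (forall y, 0 <= phi y) ->
       mass s' phi = mass s (foldr transfer phi qs))
    (fun s' => (w + words s')%N).
Proof.
move=> gs wh.
apply: (@triple_foldM _ _ (step G p alpha sigma) qs s
    (fun s' => w + words s')%N _ h (fun pre s' => good_keys s' /\
      forall phi, (forall y, 0 <= phi y) ->
      mass s' phi = mass s (foldr transfer phi pre))) => //.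
move=> pre q post acc _ [gacc macc].
have wh' : (w + words acc + B * p.+1 <= h)%N.
  by rewrite (leq_trans _ wh)// leq_add2r leq_add2l good_keys_words.
apply: (triple_weaken (triple_step q gacc wh')) => // s' [gs' ms'].
split=> // phi phi0; rewrite ms'// macc; last exact: transfer_ge0.
by rewrite foldr_rcons.
Qed.

Lemma pure_at_wrap_exponent l (r : seq nat) :
  pure_at (sumM (iota 0 (p - 1)) (fun i =>
    sumM (iota 0 (p - 1)) (fun j =>
      compute 10 (wrap_entry G p i j * (nth 0%N l i * nth 0%N r (size r - 1 - j))%:R
                     / sigma ^+ 2))))
    (wrap_exponent l r) ((p - 1) * ((p - 1) * 12).+2).
Proof.
rewrite -[in X in pure_at _ _ X](size_iota 0 (p - 1)).
apply: pure_at_sumM => i _; apply: pure_at_sumM => j _.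
exact: pure_at_compute.
Qed.

Lemma triple_collect l s (w h : nat) : good_keys s ->
  triple (collect G p alpha sigma l s) w (B * (21 * (p * p))) h
    (fun v => expeR v = mass s (closing l)) (fun=> w).
Proof.
move=> gs.
pose Inv (pre : seq key) (v : \bar R) :=
  expeR v = (\sum_(x <- pre) weight s x * (closing l x)%:E)%E.
apply: (@triple_weaken _ _ _ (size (keys s) * (20 * (p * p)).+1)%N _ h _
  (Inv (keys s)) _ (fun=> w)) => //; last first.
  by apply: leq_mul; [exact: good_keys_card|nia].
apply: (@triple_foldM _ _ _ (keys s) -oo%E (fun=> w) _ h Inv).
  by rewrite /Inv big_nil.
move=> pre x post acc es Iacc.
have xs : x \in domf s by rewrite -[_ \in _]/(x \in keys s) es mem_cat inE eqxx orbT.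
have [sx _] := gs x xs.
apply: (@triple_weaken _ _ _ (1 + ((p - 1) * ((p - 1) * 12).+2 + (p + 5)))%N _ h _
  (Inv (rcons pre x)) _ (fun=> w)) => //; last by nia.
apply: triple_pure_bind; first by move=> c; exists 1%N.
(* A key whose partial sum is not [alpha] is skipped, in agreement with the value 0 of [closing]. *)
case: ifPn => xa; last first.
  apply: triple_ret => //.
  by rewrite /Inv -cats1 big_cat/= big_seq1 /closing (negbTE xa) mule0 adde0.
apply: triple_pure_bind; first exact: pure_at_wrap_exponent.
apply: triple_pure_bind; first exact: pure_at_dict_get.
apply: (triple_weaken (@triple_pure _ _ _ w _ h (pure_at_compute _ _))) => // _ ->.
rewrite /Inv expeR_LSE Iacc -cats1 big_cat/= big_seq1 expeRD.
by rewrite /closing xa.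
Qed.

(** In order: the partial sum, the initial weight, the first insertion, [nq] rounds of step (b), and
    step (c). *)
Definition tuple_time (nq : nat) : nat :=
  p + (23 * (p * p) + (p.+1 + (nq * (B * (alpha.+1 * (32 * p))).+1
    + B * (21 * (p * p))))).

Lemma triple_tuple_sum (l : seq nat) (w h : nat) :
  l \in tuples (p - 1) alpha -> (w + B * p.+1 + B * p.+1 <= h)%N ->
  triple (tuple_sum G p alpha sigma l) w (tuple_time (b - (p - 1))) h
    (fun v => expeR v = (expR (init_exponent l) *
      foldr transfer (closing l) (iota (p - 1) (b - (p - 1))) (sumn l, l))%:E)
    (fun=> w).
Proof.
rewrite mem_tuples => /andP[/eqP sl suml] wh.
rewrite /tuple_time.
apply: triple_pure_bind.
  apply: (pure_at_weaken (pure_at_compute _ _)) => //; lia.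
apply: triple_pure_bind; first exact: pure_at_init_weight.
rewrite -[X in triple _ X](addn0 w) -[X in (_ + X)%N](@words0 R).
pose s0 : dict R := [fmap]%fmap.[(sumn l, l) <- (init_exponent l)%:E]%fmap.
have gs0 : good_keys s0.
  move=> x; rewrite dom_setf in_fset1U => /orP[/eqP ->|]; last by rewrite domf0 inE.
  by rewrite /= leqnn.
have ws0 : (w + words s0 <= h)%N.
  have := good_keys_words gs0; move: wh; lia.
have -> : p.+1 = (key_size (sumn l, l)).+1 by rewrite /key_size/= sl; lia.
apply: (triple_bind (triple_dict_set ws0)) => _ ->.
rewrite -[in X in triple _ _ (X + _)%N](size_iota (p - 1) (b - (p - 1))).
apply: (triple_bind (triple_steps _ gs0 wh)) => s [gs ms].
rewrite -[X in triple _ _ X]addn0.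
refine (triple_bind (@triple_collect l s (w + words s) h gs) _) => v vE.
apply: triple_release; apply: triple_ret; last by rewrite -/(words s); lia.
rewrite vE ms; last exact: closing_ge0.
(* Inserting into the empty dictionary is an LSE with -oo, so [mass_set] applies to the initial
   state as well. *)
have -> : s0 = [fmap]%fmap.[(sumn l, l) <-
    LSE (init_exponent l)%:E (odflt -oo%E (([fmap]%fmap : dict R).[? (sumn l, l)]%fmap))]%fmap.
  by rewrite fnd_fmap0 /LSE [X in lne X]adde0 expeRK.
rewrite mass_set; last by apply: foldr_transfer_ge0; exact: closing_ge0.
by rewrite mass0 add0e EFinM.
Qed.

(** The quantity S whose logarithm the outer loop accumulates. *)
Definition weight_sum : R :=
  \sum_(l <- tuples (p - 1) alpha) expR (init_exponent l) *
    foldr transfer (closing l) (iota (p - 1) (b - (p - 1))) (sumn l, l).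

Let nband := #|[pred x : 'I_b * 'I_b | (circ_dist x.1 x.2 < p)%N]|.

Lemma triple_account_steps :
  triple (account_steps G p alpha sigma) 0
    (3 * alpha.+1 + (4 * nband + (size (tuples (p - 1) alpha) *
      (p + (tuple_time (b - (p - 1)) + 4)).+1 + 12)))
    (alpha.+1 + nband + (3 * p + 32) + B * p.+1 + B * p.+1)
    (fun rho => rho = (((alpha%:R - 1)^-1)%:E *
       (lne weight_sum%:E + (log_fact R alpha)%:E - (alpha%:R * ln b%:R)%:E)
       + (tau G p * alpha%:R / (2 * sigma ^+ 2))%:E)%E)
    (fun=> 0 + alpha.+1 + nband + (3 * p + 32))%N.
Proof.
apply: triple_alloc; first by lia.
apply: triple_pure_bind; first by move=> c; exists (3 * alpha.+1)%N.
apply: triple_alloc; first by rewrite -/nband; lia.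
apply: triple_pure_bind; first by move=> c; exists (4 * nband)%N.
apply: triple_alloc; first by rewrite -/nband; lia.
set w := (0 + alpha.+1 + _ + _)%N.
pose term l := expR (init_exponent l) *
    foldr transfer (closing l) (iota (p - 1) (b - (p - 1))) (sumn l, l).
pose Inv (pre : seq (seq nat)) (v : \bar R) := expeR v = (\sum_(l <- pre) term l)%:E.
apply: (@triple_bind _ _ _ _ _ _ _ _ (Inv (tuples (p - 1) alpha)) (fun=> w)).
  apply: (@triple_foldM _ _ _ (tuples (p - 1) alpha) -oo%E (fun=> w) _ _ Inv).
    by rewrite /Inv big_nil.
  move=> pre l post acc et Iacc.
  have lt : l \in tuples (p - 1) alpha by rewrite et mem_cat inE eqxx orbT.
  apply: triple_pure_bind; first by move=> c; exists p.
  apply: (triple_bind (triple_tuple_sum lt _)); first by rewrite leqnn.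
  move=> v vE.
  apply: (triple_weaken (@triple_pure _ _ _ w _ (w + B * p.+1 + B * p.+1)
    (pure_at_compute _ _))) => // _ ->.
  rewrite /Inv expeR_LSE Iacc vE -cats1 big_cat/= big_seq1.
  by [].
move=> v Iv.
apply: (triple_weaken (@triple_pure _ _ _ w _ (w + B * p.+1 + B * p.+1)
    (pure_at_compute _ _))) => // _ ->.
by rewrite /weight_sum -[in RHS]Iv expeRK.
Qed.

End programs.

(** * Numerical bounds on time and storage *)

Lemma leq_bin_expn a n : (1 < a)%N -> ('C(a + n, n) <= 2 * a ^ n)%N.
Proof.
move=> a1; case: n => [|n]; first by rewrite bin0.
(* The factor 2 covers [a + 1] at exponent 1; from there each further step multiplies the binomial
   by at most [a]. *)
elim: n => [|n IH]; first by rewrite bin1 expn1; lia.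
rewrite -(leq_pmul2l (ltn0Sn n.+1)) addnS -mul_bin_diag expnS.
rewrite (@leq_trans ((a + n.+1).+1 * (2 * a ^ n.+1))%N) ?leq_mul2l ?IH ?orbT//.
rewrite mulnA mulnCA !mulnA leq_mul2r; apply/orP; right.
nia.
Qed.

(* Successive ratios of the left-hand side are at most [a] once [n >= 5]. *)
Lemma leq_sqr_bin_expn a n : (1 < a)%N ->
  (n.+1 ^ 2 * 'C(a + n, n) <= 72 * a ^ n)%N.
Proof.
move=> a1.
have small m : (m <= 5)%N -> (m.+1 ^ 2 * 'C(a + m, m) <= 72 * a ^ m)%N.
  move=> m5; rewrite (@leq_trans (36 * (2 * a ^ m))%N)//; last by rewrite mulnA.
  (* Here 72 = 36 * 2: the square is at most 6^2, and the binomial at most twice the power. *)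
  by apply: leq_mul; [rewrite (@leq_exp2r m.+1 6)|exact: leq_bin_expn].
have [|n5] := leqP n 5; first exact: small.
rewrite -(subnK (ltnW n5)); elim: (n - 5)%N => [|m IH]; first exact: small.
rewrite addSn; set k := (m + 5)%N in IH *.
have k5 : (5 <= k)%N by rewrite leq_addl.
rewrite -(@leq_pmul2l (k.+1 ^ 3))//.
have E : (k.+1 * 'C(a + k.+1, k.+1) = (a + k).+1 * 'C(a + k, k))%N.
  by rewrite addnS -mul_bin_diag.
have -> : (k.+1 ^ 3 * (k.+2 ^ 2 * 'C(a + k.+1, k.+1)) =
    k.+2 ^ 2 * (a + k).+1 * (k.+1 ^ 2 * 'C(a + k, k)))%N.
  transitivity (k.+2 ^ 2 * k.+1 ^ 2 * (k.+1 * 'C(a + k.+1, k.+1)))%N; first by ring.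
  by rewrite E; ring.
have H : (k.+2 ^ 2 * (a + k).+1 <= k.+1 ^ 3 * a)%N.
  have [m' ->] : exists m', k = (5 + m')%N by exists m; rewrite /k addnC.
  have [c ->] : exists c, a = (2 + c)%N by exists (a - 2)%N; rewrite subnKC.
  by rewrite !expnS !expn0; nia.
have -> : (k.+1 ^ 3 * (72 * a ^ k.+1) = k.+1 ^ 3 * a * (72 * a ^ k))%N.
  by rewrite [(a ^ _)%N]expnS; ring.
exact: leq_mul.
Qed.

(** A pair in the band has the form [(i, i + e mod b)] with an offset [e] in [-p, p), which leaves
    [2 * p] choices for each [i]. *)
Lemma card_band b p : (0 < b)%N -> (0 < p)%N ->
  (#|[pred x : 'I_b * 'I_b | circ_dist x.1 x.2 < p]| <= 2 * (b * p))%N.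
Proof.
move=> b0 p0.
(* The offset is [d - p]; the multiple [b * p] of [b] keeps the subtraction of natural numbers from
   truncating. *)
have F (i : 'I_b) (d : 'I_(2 * p)) : ((i + b * p - p + d) %% b < b)%N by rewrite ltn_mod.
pose f (x : 'I_b * 'I_(2 * p)) : 'I_b * 'I_b := (x.1, Ordinal (F x.1 x.2)).
have -> : (2 * (b * p) = #|{: 'I_b * 'I_(2 * p)}|)%N.
  by rewrite card_prod !card_ord; lia.
apply: leq_trans (fintype.leq_image_card f predT); apply/subset_leq_card/fintype.subsetP.
move=> [i j]; rewrite inE /circ_dist/= => ij.
have [ib jb] := (ltn_ord i, ltn_ord j).
have bp : (p <= b * p)%N by rewrite leq_pmull.
have key (d c : nat) : (d < 2 * p)%N -> (i + b * p - p + d = c * b + j)%N ->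
    (i, j) \in [seq f x | x in predT].
  move=> d2 E; apply/fintype.imageP; exists (i, Ordinal d2) => //.
  by congr (_, _); apply: val_inj; rewrite /= E modnMDl modn_small.
have bp1 : (b * p = (p - 1) * b + b)%N by rewrite -{1}(subnK p0) mulnDr muln1 mulnC.
(* The three cases are a pair close on the line, a pair close across the end with [i < j], and the
   same with [j <= i]; the quotients are [p], [p - 1] and [p + 1]. *)
have [ijp|] := ltnP `|i - j|%N p.
  by apply: (key (j + p - i)%N p); rewrite 1?[(p * b)%N]mulnC; lia.
move: ij => + pij; rewrite gtn_min ltnNge pij/= => ij.
have [ltij|leji] := ltnP i j.
  by apply: (key (p - (b - `|i - j|%N))%N (p - 1)%N); lia.
by apply: (key (p + (b - `|i - j|%N))%N p.+1); rewrite 1?[(p.+1 * b)%N]mulnC ?mulnS; lia.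
Qed.

(** The main term is the number of tuples times the rounds, the keys and the values of [t]. Terms
    quadratic in [p] are absorbed by the binomial bound carrying a square. *)
Lemma leq_account_time b p alpha nband :
  (0 < b)%N -> (0 < p)%N -> (1 < alpha)%N -> (nband <= 2 * (b * p))%N ->
  (3 * alpha.+1 + (4 * nband + (size (tuples (p - 1) alpha) *
      (p + (tuple_time p alpha (b - (p - 1)) + 4)).+1 + 12))
   <= 100 * 100 * (b * p * alpha ^ (2 * p)))%N.
Proof.
move=> b0 p0 a1 nb; rewrite size_tuples.
have a0 : (0 < alpha)%N by exact: ltnW.
have N1 := leq_bin_expn (p - 1) a1; have N2 := leq_sqr_bin_expn (p - 1) a1.
have B1 := leq_bin_expn p a1; have B2 := leq_sqr_bin_expn p a1.
rewrite /tuple_time.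
move: B1 B2 N1 N2; set N := 'C(_, p - 1); set B := 'C(_, p) => B1 B2 N1 N2.
have X0 : (0 < alpha ^ (p - 1))%N by rewrite expn_gt0 a0.
have Xp : (alpha ^ p = alpha * alpha ^ (p - 1))%N by rewrite -expnS subn1 prednK.
have X2p : (alpha ^ (2 * p) = alpha ^ p * alpha ^ p)%N by rewrite mul2n -addnn expnD.
have p1 : (p - 1).+1 = p by lia.
rewrite p1 in N2.
rewrite X2p; move: B1 B2 N1 N2 X0; rewrite Xp.
set X := (alpha ^ _)%N => B1 B2 N1 N2 X0.
set nq := (b - (p - 1))%N; have nqb : (nq <= b)%N by exact: leq_subr.
set Y := (alpha * X)%N in B1 B2 *.
have XY : (2 * X <= Y)%N by rewrite /Y leq_mul2r a1 orbT.
have pp : (p * p <= p.+1 ^ 2)%N by rewrite expnS expn1; lia.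
have bp : (b <= b * p)%N by rewrite leq_pmulr.
have pb : (p <= b * p)%N by rewrite leq_pmull.
set bp' := (b * p)%N in nb bp pb *.
have bp0 : (0 < bp')%N by rewrite /bp'; lia.
have Y0 : (0 < Y)%N by lia.
have YY : (Y <= Y * Y)%N by rewrite leq_pmulr.
have aY : (alpha <= Y)%N by rewrite /Y leq_pmulr.
set Z := (bp' * (Y * Y))%N.
have YYZ : (Y * Y <= Z)%N by rewrite /Z leq_pmull.
have bpZ : (bp' <= Z)%N by rewrite /Z leq_pmulr// muln_gt0 Y0.
have t1 : (N * (33 * (p * p)) <= 2376 * Z)%N.
  have : (N * (p * p) <= 72 * X)%N by rewrite mulnC mulnn.
  by lia.
have t2 : (N * nq <= Z)%N.
  apply: (@leq_trans (Y * bp')); last by rewrite /Z mulnC leq_mul2l YY orbT.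
  by apply: leq_mul; lia.
(* The dominant term: [N <= 2 * X], [B <= 2 * Y], [alpha.+1 <= 2 * alpha], and 256 = 2 * 2 * 2 *
   32. *)
have t3 : (N * (nq * (B * (alpha.+1 * (32 * p)))) <= 256 * Z)%N.
  apply: (@leq_trans (2 * X * (b * (2 * Y * (2 * alpha * (32 * p)))))%N).
    by do ?apply: leq_mul => //; lia.
  by rewrite /Z /bp' /Y; lia.
have t4 : (N * (B * (21 * (p * p))) <= 1512 * Z)%N.
  have h1 : (B * (p * p) <= 72 * Y)%N by rewrite mulnC (leq_trans _ B2)// leq_mul2r pp orbT.
  have : (N * (B * (p * p)) <= Y * (72 * Y))%N by apply: leq_mul => //; lia.
  by lia.
have le33 : (p + p + p.+1 + 5 + 23 * (p * p) <= 33 * (p * p))%N by nia.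
rewrite (_ : (N * _)%N = (N * (p + p + p.+1 + 5 + 23 * (p * p)) + N * nq +
  N * (nq * (B * (alpha.+1 * (32 * p)))) + N * (B * (21 * (p * p))))%N); last by ring.
have : (N * (p + p + p.+1 + 5 + 23 * (p * p)) <= N * (33 * (p * p)))%N.
  by rewrite leq_mul2l le33 orbT.
lia.
Qed.

Lemma leq_account_peak b p alpha nband :
  (0 < b)%N -> (0 < p)%N -> (1 < alpha)%N -> (nband <= 2 * (b * p))%N ->
  (alpha.+1 + nband + (3 * p + 32) + 'C(alpha + p, p) * p.+1 + 'C(alpha + p, p) * p.+1
   <= 100 * 100 * (alpha ^ p + b * p))%N.
Proof.
move=> b0 p0 a1 nb; have B2 := leq_sqr_bin_expn p a1.
move: B2; set B := 'C(_, p) => B2.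
(* The bound with a square absorbs the key length [p.+1]. *)
have h1 : (B * p.+1 <= 72 * alpha ^ p)%N.
  by rewrite mulnC (leq_trans _ B2)// leq_mul2r expnS leq_pmulr// orbT.
have aX : (alpha <= alpha ^ p)%N by rewrite -{1}(expn1 alpha) leq_exp2l.
have pb : (p <= b * p)%N by rewrite leq_pmull.
lia.
Qed.

(** * Sums over count vectors *)

Lemma sum_iota_ord (R : nmodType) n (F : nat -> R) :
  \sum_(i <- iota 0 n) F i = \sum_(i < n) F i.
Proof. by rewrite -{1}(subn0 n) -/(index_iota 0 n) big_mkord. Qed.

Section csum.
Context (R : realType).
Implicit Types (f g : seq nat -> R).

(** Sum over the count vectors of length [n] with total exactly [s], in the recursive form that
    [transfer] unfolds to. *)
Fixpoint csum (n s : nat) f : R :=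
  if n is n'.+1 then \sum_(t <- iota 0 s.+1) csum n' (s - t) (fun x => f (t :: x))
  else if s == 0%N then f [::] else 0.

Lemma csumS n s f :
  csum n.+1 s f = \sum_(t <- iota 0 s.+1) csum n (s - t) (fun x => f (t :: x)).
Proof. by []. Qed.

Lemma ler_csum n s f g :
  (forall x, size x = n -> sumn x = s -> f x <= g x) -> csum n s f <= csum n s g.
Proof.
elim: n s f g => [|n IH] s f g fg.
  by rewrite /=; case: eqVneq => // s0; exact: fg.
rewrite !csumS big_seq [leRHS]big_seq; apply: ler_sum => t; rewrite mem_iota => ts.
by apply: IH => x sx sumx; apply: fg => /=; lia.
Qed.

Lemma eq_csum n s f g :
  (forall x, size x = n -> sumn x = s -> f x = g x) -> csum n s f = csum n s g.
Proof.
move=> fg; apply/eqP; rewrite eq_le; apply/andP.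
by split; apply: ler_csum => x sx sumx; rewrite fg.
Qed.

Lemma csumZ n s (c : R) f : csum n s (fun x => c * f x) = c * csum n s f.
Proof.
elim: n s f => [|n IH] s f; first by rewrite /=; case: ifP => // _; rewrite mulr0.
by rewrite !csumS mulr_sumr; apply: eq_bigr => t _; exact: IH.
Qed.

Lemma csum_ge0 n s f : (forall x, 0 <= f x) -> 0 <= csum n s f.
Proof.
elim: n s f => [|n IH] s f f0; first by rewrite /=; case: ifP.
by rewrite csumS sumr_ge0// => t _; exact: IH.
Qed.

Lemma sum_tuples_csum n m s f :
  \sum_(l <- tuples n s) csum m (s - sumn l) (fun u => f (l ++ u)) = csum (n + m) s f.
Proof.
elim: n s f => [|n IH] s f; first by rewrite big_seq1 subn0.
rewrite tuplesS addSn csumS big_allpairs_dep; apply: eq_bigr => t _ /=.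
by rewrite -IH; apply: eq_bigr => l _; rewrite subnDA.
Qed.

Lemma csum_pad n m s f : (forall x, 0 <= f x) ->
  csum n s (fun x => f (x ++ nseq m 0%N)) <= csum (n + m) s f.
Proof.
elim: n s f => [|n IH] s f f0.
  rewrite /= add0n; case: eqVneq => [->|_]; last exact: csum_ge0.
  elim: m f f0 => //= m IHm f f0.
  by rewrite big_seq1; apply: (IHm (fun x => f (0%N :: x))).
by rewrite addSn !csumS; apply: ler_sum => t _; exact: (IH _ (fun x => f (t :: x))).
Qed.

(** The multinomial coefficient of [x] divided by the factorial of its total. *)
Definition inv_facts (x : seq nat) : R := \prod_(t <- x) (t`!)%:R^-1.

Lemma csum_inv_factsS n s f :
  csum n.+1 s (fun x => inv_facts x * f x) = \sum_(t <- iota 0 s.+1)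
    (t`!)%:R^-1 * csum n (s - t) (fun x => inv_facts x * f (t :: x)).
Proof.
rewrite csumS; apply: eq_bigr => t _; rewrite -csumZ; apply: eq_csum => x _ _.
by rewrite /inv_facts big_cons mulrA.
Qed.

(** The factor [s.+1] is the sum of the entries of the vector, and an entry divided by its factorial
    is the inverse factorial of the entry lowered by one. *)
Lemma csum_incr_nth n s f :
  s.+1%:R * csum n s.+1 (fun x => inv_facts x * f x) =
  \sum_(i <- iota 0 n) csum n s (fun x => inv_facts x * f (incr_nth x i)).
Proof.
elim: n s f => [|n IH] s f; first by rewrite /= big_nil mulr0.
rewrite csum_inv_factsS mulr_sumr.
pose F t := (t`!)%:R^-1 * csum n (s.+1 - t) (fun x => inv_facts x * f (t :: x)).
(* The total splits into the head [t] and the remainder: the first part gives index 0, the second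
   the induction hypothesis. *)
rewrite (eq_big_seq (fun t => t%:R * F t + (s.+1 - t)%:R * F t)); last first.
  move=> t; rewrite mem_iota => /andP[_ ts]; rewrite -mulrDl -natrD.
  by congr (_%:R * _); lia.
have -> : \sum_(t <- iota 0 s.+2) (t%:R * F t + (s.+1 - t)%:R * F t) =
    \sum_(t <- iota 0 s.+2) t%:R * F t + \sum_(t <- iota 0 s.+2) (s.+1 - t)%:R * F t.
  exact: big_split.
rewrite -[iota 0 n.+1]/(0%N :: iota (1 + 0) n) iotaDl [RHS]big_cons.
congr (_ + _).
  rewrite -[iota 0 s.+2]/(0%N :: iota (1 + 0) s.+1) iotaDl big_cons big_map mul0r add0r.
  rewrite csum_inv_factsS; apply: eq_bigr => t _ /=.
  by rewrite /F add1n factS natrM invfM !mulrA divff ?mul1r ?pnatr_eq0// subSS.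
have -> : \sum_(t <- iota 0 s.+2) (s.+1 - t)%:R * F t =
    \sum_(t <- iota 0 s.+1) (s.+1 - t)%:R * F t.
  by rewrite -[s.+2]addn1 iotaD big_cat/= big_seq1 add0n subnn mul0r addr0.
rewrite big_map.
under [RHS]eq_bigr => i _.
  rewrite (csum_inv_factsS _ _ (fun x => f (incr_nth x (1 + i)))); over.
rewrite [RHS]exchange_big big_seq [RHS]big_seq; apply: eq_bigr => t.
rewrite mem_iota => /andP[_ ts].
rewrite /F subSn; last by lia.
by rewrite mulrCA IH mulr_sumr.
Qed.

End csum.

Section multinomial.
Context (R : realType) (b : nat).

Definition counts a (r : {ffun 'I_a -> 'I_b}) : seq nat :=
  mkseq (fun i => \sum_(j < a) (r j == i :> nat))%N b.

Lemma sum_counts a (r : {ffun 'I_a -> 'I_b}) (g : 'I_b -> R) :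
  \sum_(j < a) g (r j) = \sum_(i < b) (nth 0%N (counts r) i)%:R * g i.
Proof.
under [RHS]eq_bigr do rewrite nth_mkseq// natr_sum mulr_suml.
rewrite exchange_big/=; apply: eq_bigr => j _.
rewrite (bigD1 (r j))//= eqxx mul1r big1 ?addr0// => i ij.
by rewrite -val_eqE/= in ij; rewrite eq_sym (negbTE ij) mul0r.
Qed.

Let cons_ffun a (x : 'I_b * {ffun 'I_a -> 'I_b}) : {ffun 'I_a.+1 -> 'I_b} :=
  [ffun j => if unlift ord0 j is Some j' then x.2 j' else x.1].

Let counts_cons a (x : 'I_b * {ffun 'I_a -> 'I_b}) :
  counts (cons_ffun x) = incr_nth (counts x.2) x.1.
Proof.
apply: (@eq_from_nth _ 0%N).
  by rewrite size_incr_nth !size_mkseq ltn_ord.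
move=> i; rewrite size_mkseq => ib; rewrite nth_incr_nth !nth_mkseq//.
rewrite big_ord_recl ffunE unlift_none; congr (_ + _)%N.
by apply: eq_bigr => j _; rewrite ffunE liftK.
Qed.

(** The multinomial theorem, by induction on [a]: the first entry of [r] raises one count, and
    [csum_incr_nth] collects the choices. *)
Lemma sum_ffun_counts a (f : seq nat -> R) :
  \sum_(r : {ffun 'I_a -> 'I_b}) f (counts r) =
  (a`!)%:R * csum b a (fun x => inv_facts R x * f x).
Proof.
elim: a f => [|a IH] f.
  rewrite fact0 mul1r.
  have -> : csum b 0 (fun x => inv_facts R x * f x) = f (nseq b 0%N).
    elim: b f => [|n IHn] f; first by rewrite /= /inv_facts big_nil mul1r.
    by rewrite csum_inv_factsS big_seq1 fact0 invr1 mul1r (IHn (fun x => f (_ :: x))).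
  rewrite (eq_bigr (fun=> f (nseq b 0%N))); last first.
    move=> r _; congr f; apply: (@eq_from_nth _ 0%N).
      by rewrite size_mkseq size_nseq.
    move=> i; rewrite size_mkseq => ib.
    by rewrite nth_mkseq// nth_nseq ib big_ord0.
  by rewrite sumr_const card_ffun !card_ord expn0 mulr1n.
rewrite (reindex (@cons_ffun a)); last first.
  exists (fun r : {ffun 'I_a.+1 -> 'I_b} =>
      (r ord0, [ffun j : 'I_a => r (lift ord0 j)])) => [[i r] _|r _].
    congr (_, _); first by rewrite ffunE unlift_none.
    by apply/ffunP => j; rewrite !ffunE liftK.
  apply/ffunP => j; rewrite ffunE; case: unliftP => [j' ->|->]//=.
  by rewrite ffunE.
under eq_bigr do rewrite counts_cons.
rewrite -(pair_bigA _ (fun (i : 'I_b) (r : {ffun 'I_a -> 'I_b}) => f (incr_nth (counts r) i)))/=.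
rewrite factS natrM mulrAC mulrC csum_incr_nth mulr_sumr.
rewrite sum_iota_ord; apply: eq_bigr => i _.
by rewrite (IH (fun x => f (incr_nth x i))).
Qed.

(** The interaction of ordered pairs of distinct positions in terms of counts; the subtracted sum
    removes each position paired with itself. *)
Definition pair_energy (M : 'M[R]_b) (c : R) (x : seq nat) : R :=
  (\sum_(i < b) \sum_(j < b) M i j * (nth 0%N x i)%:R * (nth 0%N x j)%:R
   - \sum_(i < b) M i i * (nth 0%N x i)%:R) / c.

Lemma pair_energy_counts (M : 'M[R]_b) (c : R) a (r : {ffun 'I_a -> 'I_b}) :
  \sum_(j1 < a) \sum_(j2 < a | j1 != j2) M (r j1) (r j2) / c =
  pair_energy M c (counts r).
Proof.
have D j1 : \sum_(j2 < a | j1 != j2) M (r j1) (r j2) / c =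
    (\sum_(j2 < a) M (r j1) (r j2) - M (r j1) (r j1)) / c.
  rewrite [in RHS](bigD1 j1)//= addrAC subrr add0r mulr_suml.
  by apply: eq_bigl => j2; rewrite eq_sym.
under eq_bigr do rewrite D.
rewrite -mulr_suml sumrB; congr ((_ - _) / _).
  rewrite (sum_counts r (fun i => \sum_(j2 < a) M i (r j2))).
  apply: eq_bigr => i _; rewrite (sum_counts r (M i)) mulr_sumr.
  by apply: eq_bigr => j _; ring.
rewrite (sum_counts r (fun i => M i i)).
by apply: eq_bigr => i _; rewrite mulrC.
Qed.

End multinomial.

(** * The exponent accumulated by the program *)

(** Brings sums over different index ranges to a common range, where they are compared term by
    term. *)
Lemma sum_iota_cond (R : nmodType) m n b (F : nat -> R) : (m + n <= b)%N ->
  \sum_(i <- iota m n) F i = \sum_(i <- iota 0 b | (m <= i < m + n)%N) F i.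
Proof.
move=> mnb; rewrite -[RHS]big_filter; apply/perm_big/uniq_perm.
- exact: iota_uniq.
- by rewrite filter_uniq ?iota_uniq.
- by move=> i; rewrite mem_filter !mem_iota; apply/idP/idP; lia.
Qed.

Lemma sum_iota_rev (R : nmodType) n b (F : nat -> R) : (n <= b)%N ->
  \sum_(j <- iota 0 n) F (b - 1 - j)%N = \sum_(j <- iota (b - n) n) F j.
Proof.
move=> nb; rewrite -[in RHS](addn0 (b - n)%N) iotaDl big_map !sum_iota_ord.
rewrite [RHS](reindex_inj rev_ord_inj)/=; apply: eq_bigr => j _.
by congr F; have := ltn_ord j; lia.
Qed.

Lemma sum_sym_square (R : comPzRingType) n (F : nat -> nat -> R) :
  (forall i j, F i j = F j i) ->
  \sum_(i < n) \sum_(j < n) F i j =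
  \sum_(i < n) F i i + 2 * \sum_(j <- iota 0 n) \sum_(i <- iota 0 j) F i j.
Proof.
move=> FC; under [X in _ + _ * X]eq_bigr do rewrite sum_iota_ord.
rewrite sum_iota_ord; elim: n => [|n IH]; first by rewrite !big_ord0 mulr0 addr0.
rewrite [in RHS]big_ord_recr [X in _ = _ + _ * X]big_ord_recr/=.
rewrite big_ord_recr/=.
under eq_bigr do rewrite big_ord_recr/=.
have E : \sum_(j < n) F n j = \sum_(j < n) F j n by apply: eq_bigr => j _; exact: FC.
by rewrite big_split/= IH big_ord_recr/= E; ring.
Qed.

Section exponent.
Context (R : realType) (b : nat) (G : 'M[R]_b) (p alpha : nat) (sigma : R).
Hypothesis p0 : (0 < p)%N.
Local Notation d := (p - 1)%N.

Definition suffix (y : seq nat) : seq nat := drop (size y - d) y.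

Lemma push_val_suffix y t : (d <= size y)%N ->
  push_val p (suffix y) t = suffix (rcons y t).
Proof.
move=> sy; rewrite /push_val /suffix size_rcons size_drop.
case: eqVneq => [p1|p1]; first by rewrite p1 subnn !subn0 drop_oversize ?size_rcons.
rewrite (_ : (size y - (size y - d) < d)%N = false); last by lia.
have -> : ((size y).+1 - d = (size y - d).+1)%N by lia.
rewrite drop_rcons; last by lia.
by rewrite -drop1 drop_drop add1n.
Qed.

Definition steps_exponent q n (y : seq nat) : R :=
  \sum_(i <- iota q n) delta G p sigma i (suffix (take i y)) (nth 0%N y i).

(** The history [y] is seen only through the key [(sumn y, suffix y)]. Each transfer appends one
    entry, and the test in [closing] is the base case of [csum]. *)
Lemma foldr_transfer_csum l n y : (d <= size y)%N -> (sumn y <= alpha)%N ->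
  foldr (transfer G p alpha sigma) (closing G p alpha sigma l)
    (iota (size y) n) (sumn y, suffix y) =
  csum n (alpha - sumn y) (fun u => expR (steps_exponent (size y) n (y ++ u)
    + wrap_exponent G p sigma l (suffix (y ++ u)))).
Proof.
elim: n y => [|n IH] y sy sumy.
  rewrite /= cats0 /closing/= /steps_exponent big_nil add0r subn_eq0.
  by rewrite eqn_leq sumy.
rewrite csumS [LHS]/(transfer _ _ _ _ _ _ _) /transfer big_seq [RHS]big_seq.
apply: eq_bigr => t; rewrite mem_iota => /andP[_ /= ts].
have tS : sumn (rcons y t) = (sumn y + t)%N by rewrite sumn_rcons.
have := IH (rcons y t); rewrite size_rcons tS -push_val_suffix// => IHt.
rewrite [X in _ * X]IHt; [|by lia|by lia].
rewrite -csumZ subnDA; apply: eq_csum => u _ _.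
rewrite -expRD addrA /steps_exponent big_cons cat_rcons; congr expR.
congr (_ + _ + _); congr (delta _ _ _ _ _ _); first by rewrite take_size_cat.
by rewrite nth_cat ltnn subnn.
Qed.

(** What steps (a), (b) and (c) together add up for the count vector [x]. *)
Definition total_exponent (x : seq nat) : R :=
  init_exponent G p sigma (take d x) + steps_exponent d (b - d) x
  + wrap_exponent G p sigma (take d x) (suffix x).

Lemma weight_sum_csum :
  weight_sum G p alpha sigma =
  csum (d + (b - d)) alpha (fun x => expR (total_exponent x)).
Proof.
rewrite -sum_tuples_csum /weight_sum big_seq [RHS]big_seq; apply: eq_bigr => l.
rewrite mem_tuples => /andP[/eqP sl suml].
have sE : suffix l = l by rewrite /suffix sl subnn drop0.
have := @foldr_transfer_csum l (b - d) l; rewrite sE sl => -> //.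
rewrite -csumZ; apply: eq_csum => u _ _.
by rewrite -expRD /total_exponent take_size_cat// addrA.
Qed.

Definition pair_term (x : seq nat) (i j : nat) : R :=
  entry G p i j * (nth 0%N x i * nth 0%N x j)%:R / sigma ^+ 2.

Definition diag_term (x : seq nat) (i : nat) : R :=
  entry G p i i * (nth 0%N x i * (nth 0%N x i - 1))%:R / (2 * sigma ^+ 2)
  - log_fact R (nth 0%N x i).

(** The intended exponent, with each unordered pair of indices counted once. *)
Definition full_exponent (x : seq nat) : R :=
  \sum_(i <- iota 0 b) diag_term x i
  + \sum_(j <- iota 0 b) \sum_(i <- iota 0 j) pair_term x i j.

Lemma init_exponentE x :
  init_exponent G p sigma (take d x) =
  \sum_(j <- iota 0 d) \sum_(i <- iota 0 j) pair_term x i j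
  + \sum_(i <- iota 0 d) diag_term x i.
Proof.
congr (_ + _); apply: eq_big_seq => j; rewrite mem_iota => /andP[_ jd].
  apply: eq_big_seq => i; rewrite mem_iota => /andP[_ ij].
  by rewrite /pair_term !nth_take//; lia.
by rewrite /diag_term !nth_take.
Qed.

Hypothesis GC : forall i j, G i j = G j i.
Hypothesis sigma0 : 0 < sigma.

Lemma circ_distC (i j : 'I_b) : circ_dist i j = circ_dist j i.
Proof. by rewrite /circ_dist distnC. Qed.

Lemma entryC i j : entry G p i j = entry G p j i.
Proof.
rewrite /entry; case: insub => [i'|]; case: insub => [j'|] //.
by rewrite !mxE circ_distC GC.
Qed.

Lemma entry_ge0 i j : 0 <= entry G p i j.
Proof.
rewrite /entry; case: insub => [i'|//]; case: insub => [j'|//].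
by rewrite mxE; case: ifP => // _; rewrite le_max lexx orbT.
Qed.

Lemma entry_ord (i j : 'I_b) : entry G p i j = band G p i j.
Proof. by rewrite /entry !valK. Qed.

Lemma entry_oversize i j : (b <= i)%N -> entry G p i j = 0.
Proof. by move=> bi; rewrite /entry insubF// ltnNge bi. Qed.

Lemma pair_term_ge0 x i j : 0 <= pair_term x i j.
Proof. by rewrite /pair_term mulr_ge0 ?mulr_ge0 ?entry_ge0// invr_ge0 sqr_ge0. Qed.

(** Linear distance at least [p] leaves a nonzero entry only if the pair is close across the end,
    which forces [i] among the first and [j] among the last [p - 1] indices. *)
Lemma pair_term_far x i j : (i + p <= j)%N -> (j < b)%N ->
  ~~ ((i < d) && (b - d <= j))%N -> pair_term x i j = 0.
Proof.
move=> ij jb wr; have ib : (i < b)%N by lia.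
rewrite /pair_term (entry_ord (Ordinal ib) (Ordinal jb)) mxE /circ_dist/=.
by rewrite ifF ?mul0r//; lia.
Qed.

(** The suffix holds the entries at [q - d] up to [q - 1], and the 2 in [delta] cancels that of the
    denominator. *)
Lemma delta_suffix x q : (d <= q)%N -> (q < size x)%N ->
  delta G p sigma q (suffix (take q x)) (nth 0%N x q) =
  diag_term x q + \sum_(i <- iota (q - d) d) pair_term x i q.
Proof.
move=> dq qx; have sq : size (take q x) = q by rewrite size_takel// ltnW.
have ss : size (suffix (take q x)) = d by rewrite /suffix size_drop sq; lia.
rewrite /delta ss -(addn0 (q - d)%N) iotaDl big_map addn0.
have -> : \sum_(i <- iota 0 d) pair_term x (q - d + i) q =
    (\sum_(i <- iota 0 d) entry G p q (q - d + i) *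
      (nth 0%N (suffix (take q x)) i)%:R) * (nth 0%N x q)%:R / sigma ^+ 2.
  rewrite !mulr_suml; apply: eq_big_seq => i; rewrite mem_iota => /andP[_ id].
  rewrite /suffix sq nth_drop nth_take; last by lia.
  by rewrite /pair_term entryC natrM mulrA.
rewrite /diag_term; field.
by rewrite gt_eqF.
Qed.

Lemma wrap_exponentE x : (d <= b)%N -> size x = b ->
  wrap_exponent G p sigma (take d x) (suffix x) =
  \sum_(j <- iota (b - d) d) \sum_(i <- iota 0 d) pair_term x i j.
Proof.
move=> db sx; rewrite -sum_iota_rev// /wrap_exponent exchange_big.
apply: eq_big_seq => j; rewrite mem_iota => /andP[_ jd].
apply: eq_big_seq => i; rewrite mem_iota => /andP[_ id].
rewrite /wrap_entry ifT; last by lia.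
rewrite nth_take// /suffix sx size_drop sx nth_drop /pair_term.
by congr (_ * (_ * nth _ _ _)%:R / _); lia.
Qed.

(** The first indicator marks the pairs met in steps (a) and (b), the second those met in step (c);
    a pair satisfying both is counted twice. *)
Lemma total_exponentE x : (d <= b)%N -> size x = b ->
  total_exponent x = \sum_(i <- iota 0 b) diag_term x i
  + \sum_(j <- iota 0 b) \sum_(i <- iota 0 b)
      ((if (i < j < i + p)%N then pair_term x i j else 0)
       + if ((i < d) && (b - d <= j))%N then pair_term x i j else 0).
Proof.
move=> db sx.
rewrite /total_exponent init_exponentE wrap_exponentE//.
have -> : steps_exponent d (b - d) x = \sum_(q <- iota d (b - d)) diag_term x q
    + \sum_(q <- iota d (b - d)) \sum_(i <- iota (q - d) d) pair_term x i q.
  rewrite -big_split; apply: eq_big_seq => q; rewrite mem_iota => /andP[dq qb].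
  by rewrite delta_suffix//; lia.
have bE : iota 0 b = iota 0 d ++ iota d (b - d).
  by rewrite -{2}(add0n d) -iotaD subnKC.
have -> : \sum_(i <- iota 0 b) diag_term x i =
    \sum_(i <- iota 0 d) diag_term x i + \sum_(i <- iota d (b - d)) diag_term x i.
  by rewrite bE big_cat.
under [X in _ = _ + X]eq_bigr do rewrite big_split/=.
rewrite [X in _ = _ + X]big_split/=.
have -> : \sum_(j <- iota (b - d) d) \sum_(i <- iota 0 d) pair_term x i j =
  \sum_(j <- iota 0 b) \sum_(i <- iota 0 b)
     if ((i < d) && (b - d <= j))%N then pair_term x i j else 0.
  rewrite (@sum_iota_cond _ _ _ b); last by lia.
  rewrite big_mkcond; apply: eq_big_seq => j; rewrite mem_iota => /andP[_ jb].
  case: ifP => jd; last first.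
    by rewrite big1// => i _; rewrite ifF//; lia.
  rewrite (@sum_iota_cond _ _ _ b); last by lia.
  rewrite big_mkcond; apply: eq_bigr => i _.
  by congr (if _ then _ else _); lia.
have -> : \sum_(j <- iota 0 b) \sum_(i <- iota 0 b)
    (if (i < j < i + p)%N then pair_term x i j else 0) =
  \sum_(j <- iota 0 d) \sum_(i <- iota 0 j) pair_term x i j +
  \sum_(q <- iota d (b - d)) \sum_(i <- iota (q - d) d) pair_term x i q.
  rewrite [X in \sum_(j <- X) _ = _]bE big_cat/=; congr (_ + _); apply: eq_big_seq => j;
    rewrite mem_iota => /andP[jd jb].
    rewrite [RHS](@sum_iota_cond _ _ _ b); last by lia.
    rewrite [RHS]big_mkcond; apply: eq_bigr => i _.
    by congr (if _ then _ else _); lia.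
  rewrite [RHS](@sum_iota_cond _ _ _ b); last by lia.
  rewrite [RHS]big_mkcond; apply: eq_bigr => i _.
  by congr (if _ then _ else _); lia.
by ring.
Qed.

Lemma full_exponentE x :
  full_exponent x = \sum_(i <- iota 0 b) diag_term x i
  + \sum_(j <- iota 0 b) \sum_(i <- iota 0 b) if (i < j)%N then pair_term x i j else 0.
Proof.
congr (_ + _); apply: eq_big_seq => j; rewrite mem_iota => /andP[_ jb].
rewrite (@sum_iota_cond _ _ _ b); last by lia.
by rewrite big_mkcond.
Qed.

Lemma le_full_exponent x : (d <= b)%N -> size x = b ->
  full_exponent x <= total_exponent x.
Proof.
move=> db sx; rewrite full_exponentE total_exponentE// lerD2l.
rewrite big_seq [leRHS]big_seq; apply: ler_sum => j; rewrite mem_iota => /andP[_ jb].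
apply: ler_sum => i _; have T0 := pair_term_ge0 x i j.
case: (boolP (i < j)%N) => ij; last by rewrite addr_ge0//; case: ifP.
case: (ltnP j (i + p)) => jip /=; first by rewrite lerDl; case: ifP.
by rewrite add0r; case: ifPn => // wr; rewrite pair_term_far.
Qed.

Lemma eq_full_exponent x : (3 * d <= b)%N -> size x = b ->
  full_exponent x = total_exponent x.
Proof.
move=> db sx; have db' : (d <= b)%N by lia.
rewrite full_exponentE total_exponentE//; congr (_ + _).
apply: eq_big_seq => j; rewrite mem_iota => /andP[_ jb].
apply: eq_bigr => i _.
(* Such a pair has [j - i >= b - 2 * d + 1 >= p], so the two indicators exclude each other. *)
case: (boolP ((i < d) && (b - d <= j))%N) => wr.
  rewrite (_ : (i < j)%N = true); last by lia.
  by rewrite (_ : (j < i + p)%N = false) ?add0r//; lia.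
rewrite addr0; case: (boolP (i < j)%N) => //= ij.
by case: (ltnP j (i + p)) => // jip; rewrite pair_term_far.
Qed.

(** When [b < p - 1] the program's tuples are longer than [b]; padding by zeros places [x] among
    them, and the added indices contribute nothing negative. *)
Lemma le_full_exponent_pad x : (b < d)%N -> size x = b ->
  full_exponent x <= total_exponent (x ++ nseq (d - b) 0%N).
Proof.
move=> bd sx; set y := x ++ _.
have sy : size y = d by rewrite size_cat size_nseq sx subnKC// ltnW.
rewrite /total_exponent init_exponentE.
rewrite (_ : (b - d = 0)%N); last by lia.
rewrite /steps_exponent big_nil addr0.
have wge : 0 <= wrap_exponent G p sigma (take d y) (suffix y).
  apply: sumr_ge0 => i _; apply: sumr_ge0 => j _.
  rewrite mulr_ge0 ?mulr_ge0 ?invr_ge0 ?sqr_ge0//.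
  by rewrite /wrap_entry; case: ifP => // _; exact: entry_ge0.
rewrite -[leLHS]addr0 lerD// /full_exponent addrC.
have yE i : (i < b)%N -> nth 0%N y i = nth 0%N x i by move=> ib; rewrite nth_cat sx ib.
have y0 i : (b <= i)%N -> nth 0%N y i = 0%N.
  by move=> bi; rewrite nth_cat sx ltnNge bi/= nth_nseq; case: ifP.
have dE : iota 0 d = iota 0 b ++ iota b (d - b).
  by rewrite -{2}(add0n b) -iotaD subnKC// ltnW.
apply: lerD; rewrite dE big_cat/= -[leLHS]addr0; apply: lerD.
- rewrite le_eqVlt; apply/orP; left; apply/eqP; apply: eq_big_seq => j; rewrite mem_iota => /andP[_ jb].
  apply: eq_big_seq => i; rewrite mem_iota => /andP[_ ij].
  by rewrite /pair_term !yE//; lia.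
- by apply: sumr_ge0 => j _; apply: sumr_ge0 => i _; exact: pair_term_ge0.
- rewrite le_eqVlt; apply/orP; left; apply/eqP; apply: eq_big_seq => j; rewrite mem_iota => /andP[_ jb].
  by rewrite /diag_term !yE//; lia.
rewrite big_seq; apply: sumr_ge0 => i; rewrite mem_iota => /andP[bi _].
by rewrite /diag_term y0// entry_oversize// !mul0r sub0r /log_fact fact0 ln1 oppr0.
Qed.

Lemma expR_full_exponent x : size x = b ->
  expR (full_exponent x) =
  inv_facts R x * expR (pair_energy (band G p) (2 * sigma ^+ 2) x).
Proof.
move=> sx.
have -> : inv_facts R x = expR (- \sum_(i < b) log_fact R (nth 0%N x i)).
  rewrite -sumrN expR_sum /inv_facts (big_nth 0%N) sx big_mkord.
  apply: eq_bigr => i _.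
  by rewrite expRN /log_fact lnK// posrE ltr0n fact_gt0.
rewrite -expRD; congr expR; rewrite /full_exponent !sum_iota_ord.
rewrite /pair_energy.
pose F i j : R := entry G p i j * (nth 0%N x i * nth 0%N x j)%:R.
have -> : \sum_(i < b) \sum_(j < b)
    band G p i j * (nth 0%N x i)%:R * (nth 0%N x j)%:R =
    \sum_(i < b) \sum_(j < b) F i j.
  apply: eq_bigr => i _; apply: eq_bigr => j _.
  by rewrite /F entry_ord natrM mulrA.
have FC i j : F i j = F j i by rewrite /F entryC mulnC.
rewrite (sum_sym_square b FC).
have -> : \sum_(j < b) \sum_(i <- iota 0 j) pair_term x i j =
    (\sum_(j <- iota 0 b) \sum_(i <- iota 0 j) F i j) / sigma ^+ 2.
  rewrite sum_iota_ord mulr_suml; apply: eq_bigr => j _.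
  by rewrite mulr_suml.
have -> : \sum_(i < b) diag_term x i =
    (\sum_(i < b) F i i - \sum_(i < b) band G p i i * (nth 0%N x i)%:R)
      / (2 * sigma ^+ 2) - \sum_(i < b) log_fact R (nth 0%N x i).
  rewrite -sumrB mulr_suml -sumrB; apply: eq_bigr => i _.
  rewrite /diag_term -entry_ord /F; congr (_ / _ - _).
  rewrite -mulrBr; congr (_ * _).
  (* At the value 0 the truncated predecessor is multiplied by 0. *)
  case: (nth 0%N x i) => [|n]; first by rewrite !mul0n subrr.
  by rewrite subn1 mulnS natrD addrAC subrr add0r.
field.
by rewrite gt_eqF.
Qed.

End exponent.

(** * Comparison of the program's sum with the energy sum *)

Section weight_sum_bounds.
Context (R : realType) (b : nat) (G : 'M[R]_b) (p alpha : nat) (sigma : R).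
Hypotheses (p0 : (0 < p)%N) (GC : forall i j, G i j = G j i) (sigma0 : 0 < sigma).

(** For [M = gram C] this is the sum under the logarithm in V. *)
Definition energy_sum (M : 'M[R]_b) : R :=
  \sum_(r : {ffun 'I_alpha -> 'I_b})
    expR (\sum_(j1 < alpha) \sum_(j2 < alpha | j1 != j2)
            M (r j1) (r j2) / (2 * sigma ^+ 2)).

Lemma energy_sum_band : energy_sum (band G p) =
  (alpha`!)%:R * csum b alpha (fun x => expR (full_exponent G p sigma x)).
Proof.
rewrite /energy_sum; under eq_bigr do rewrite pair_energy_counts.
rewrite (@sum_ffun_counts _ _ alpha (fun x => expR (pair_energy _ _ x))); congr (_ * _).
by apply: eq_csum => x sx _; rewrite expR_full_exponent.
Qed.

Lemma le_energy_weight_sum :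
  energy_sum (band G p) <= (alpha`!)%:R * weight_sum G p alpha sigma.
Proof.
rewrite energy_sum_band ler_wpM2l// weight_sum_csum//.
case: (leqP (p - 1) b) => db.
  by rewrite subnKC//; apply: ler_csum => x sx _; rewrite ler_expR le_full_exponent.
rewrite (_ : (p - 1 + (b - (p - 1)) = b + (p - 1 - b))%N); last by lia.
apply: le_trans (csum_pad _ _ _ _); last by move=> x; exact: expR_ge0.
by apply: ler_csum => x sx _; rewrite ler_expR le_full_exponent_pad.
Qed.

Lemma eq_energy_weight_sum : (3 * (p - 1) <= b)%N ->
  energy_sum (band G p) = (alpha`!)%:R * weight_sum G p alpha sigma.
Proof.
move=> db; rewrite energy_sum_band weight_sum_csum// subnKC; last by lia.
by congr (_ * _); apply: eq_csum => x sx _; rewrite eq_full_exponent.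
Qed.

Lemma le_band_tau i j : G i j <= band G p i j + tau G p.
Proof.
rewrite mxE; case: ifPn => [_|]; first by rewrite -lerBlDr le_max lexx.
rewrite -leqNgt add0r => pij.
exact: (le_bigmax_cond _ (fun x : 'I_b * 'I_b => G x.1 x.2) (j := (i, j))).
Qed.

Lemma le_energy_sum_tau : (0 < alpha)%N ->
  energy_sum G <= energy_sum (band G p) *
    expR ((alpha%:R - 1) * (tau G p * alpha%:R / (2 * sigma ^+ 2))).
Proof.
move=> a0; rewrite mulr_suml; apply: ler_sum => r _; rewrite -expRD ler_expR.
(* There are [alpha * (alpha - 1)] ordered pairs of distinct positions, each costing at most
   [tau / (2 * sigma ^+ 2)]. *)
have -> : (alpha%:R - 1) * (tau G p * alpha%:R / (2 * sigma ^+ 2)) =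
    \sum_(j1 < alpha) \sum_(j2 < alpha | j1 != j2) tau G p / (2 * sigma ^+ 2).
  under eq_bigr => j1 _.
    rewrite sumr_const (eq_card (B := predC1 j1)); last by move=> j; rewrite !inE eq_sym.
    by rewrite cardC1 card_ord; over.
  rewrite sumr_const card_ord -[_ *+ alpha]mulr_natr -[_ *+ alpha.-1]mulr_natr.
  have -> : alpha.-1%:R = alpha%:R - 1 :> R.
    by rewrite -[in RHS](prednK a0) -natr1 addrK.
  by ring.
rewrite -big_split; apply: ler_sum => j1 _; rewrite -big_split; apply: ler_sum => j2 _.
by rewrite /= -mulrDl ler_wpM2r ?le_band_tau// invr_ge0 mulr_ge0// sqr_ge0.
Qed.

Lemma energy_sum_gt0 M : (0 < b)%N -> 0 < energy_sum M.
Proof. exact: sum_expR_gt0. Qed.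

End weight_sum_bounds.

(** * The Gram matrix of a banded strategy matrix *)

Section gram.
Context (R : realType) (k b : nat) (C : 'M[R]_(k * b)).

Lemma gramC i j : gram C i j = gram C j i.
Proof. by rewrite !mxE; apply: eq_bigr => s _; rewrite mulrC. Qed.

Lemma mean_vec_ge0 i s : 0 <= mean_vec C i s 0.
Proof. by rewrite summxE sumr_ge0// => j _; rewrite !mxE. Qed.

Lemma gram_ge0 i j : 0 <= gram C i j.
Proof. by rewrite mxE sumr_ge0// => s _; rewrite mulr_ge0 ?mean_vec_ge0. Qed.

Lemma mean_vec_support p i s : lower_triangular C -> banded p C ->
  mean_vec C i s 0 != 0 -> exists u e : nat, (e < p)%N /\ s = (u * b + i + e)%N :> nat.
Proof.
move=> lC bC; apply: contraNP => H.
rewrite summxE big1// => j _; rewrite !mxE.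
have [sj|js] := ltnP s (batch_col i j); first by rewrite lC// normr0.
have [jps|sjp] := leqP (batch_col i j + p) s; first by rewrite bC// normr0.
case: H; exists j, (s - batch_col i j)%N; split; first by lia.
by rewrite -[(j * b + i)%N]/(nat_of_ord (batch_col i j)) subnKC.
Qed.

(** A coordinate in both supports gives two expressions for [s], so [i] and [j] differ modulo [b] by
    less than [p]. *)
Lemma gram_banded p i j : lower_triangular C -> banded p C ->
  (p <= circ_dist i j)%N -> gram C i j = 0.
Proof.
move=> lC bC pij; rewrite mxE big1// => s _; apply/eqP; rewrite mulf_eq0.
apply: contraT; rewrite negb_or => /andP[/(mean_vec_support lC bC)[u [e [ep su]]]].
move=> /(mean_vec_support lC bC)[u' [e' [ep' su']]].
move: pij; rewrite /circ_dist leq_min => /andP[pij pbij].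
have [ib jb] := (ltn_ord i, ltn_ord j).
have E : (u * b + i + e = u' * b + j + e')%N by rewrite -su -su'.
(* Makes the gap between distinct multiples of [b] at least [b] in a form usable by linear
   arithmetic. *)
have step (v v' : nat) : (v < v')%N -> exists w, (v' * b = w + v * b + b)%N.
  move=> vv; exists ((v' - v - 1) * b)%N.
  by rewrite -mulnDl -mulSnr; congr (_ * _)%N; lia.
case: (ltngtP u u') => [/step[w wE]|/step[w wE]|uu].
- by exfalso; lia.
- by exfalso; lia.
by exfalso; rewrite uu in E; lia.
Qed.

Lemma tau_banded p : lower_triangular C -> banded p C -> tau (gram C) p = 0.
Proof.
move=> lC bC; rewrite /tau big1_idem//= ?maxxx//.
by move=> [i j] /= pij; exact: gram_banded lC bC pij.
Qed.

Lemma band_banded p : lower_triangular C -> banded p C -> band (gram C) p = gram C.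
Proof.
move=> lC bC; apply/matrixP => i j; rewrite mxE tau_banded// subr0.
case: ifPn => [_|]; first by rewrite max_l// gram_ge0.
by rewrite -leqNgt => pij; rewrite (gram_banded lC bC pij).
Qed.

End gram.

(* If b < 3p - 3, step 3(c) counts again interactions already counted in 3(a)
   or 3(b), so exactness on banded matrices needs 3p - 3 <= b; the inequality
   rho >= V holds in every case. *)
Theorem lemma3p3 (R : realType) :
  exists K : nat,
  forall (k b p alpha : nat) (sigma : R) (C : 'M[R]_(k * b)),
    (1 <= k)%N -> (1 <= b)%N -> (1 <= p)%N -> (2 <= alpha)%N -> 0 < sigma ->
    lower_triangular C ->
    (forall s t, 0 <= C s t) ->
    let V := V_alpha sigma alpha C in
    let rho := (accountant C p alpha sigma).1 in
    let cost := (accountant C p alpha sigma).2 in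
    [/\ renyi alpha%:R (P_hat sigma C) (Q_hat k b sigma) = V%:E,
        banded p C -> (3 * (p - 1) <= b)%N -> rho = V%:E,
        (V%:E <= rho)%E,
        (time cost <= K * (b * p * alpha ^ (2 * p)))%N
      & (peak cost <= K * (alpha ^ p + b * p))%N].
Proof.
exists (100 * 100)%N => k b p alpha sigma C _ b0 p0 a1 sigma0 lC _ V rho cost.
have a0 : (0 < alpha)%N by exact: ltnW.
have nband := card_band b0 p0.
have /(_ (Meter 0 0 0) erefl)[] := @triple_account_steps R b (gram C) p alpha sigma p0.
rewrite -/(run _) -/(accountant C p alpha sigma) -/rho -/cost add0n max0n.
move=> rhoE timeE _ peakE.
set S := weight_sum (gram C) p alpha sigma in rhoE.
set t := tau (gram C) p in rhoE.
have GC := gramC C.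
have f0 : 0 < (alpha`!)%:R :> R by rewrite ltr0n fact_gt0.
have leS : energy_sum alpha sigma (band (gram C) p) <= (alpha`!)%:R * S.
  exact: le_energy_weight_sum.
(* Positivity makes the extended logarithm of [S] a real one. *)
have S0 : 0 < S.
  by rewrite -(pmulr_rgt0 _ f0) (lt_le_trans _ leS)// energy_sum_gt0.
have a1' : 0 < alpha%:R - 1 :> R by rewrite subr_gt0 ltr1n.
have {}rhoE : rho = ((alpha%:R - 1)^-1 * ln ((alpha`!)%:R * S)
    - alpha%:R * ln b%:R / (alpha%:R - 1) + t * alpha%:R / (2 * sigma ^+ 2))%:E.
  transitivity ((alpha%:R - 1)^-1 * (ln S + log_fact R alpha - alpha%:R * ln b%:R)
    + t * alpha%:R / (2 * sigma ^+ 2))%:E; first by rewrite rhoE lne_EFin.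
  congr (_ + _)%:E.
  rewrite lnM ?posrE// /log_fact; field.
  by rewrite gt_eqF.
have VE : V = (alpha%:R - 1)^-1 * ln (energy_sum alpha sigma (gram C))
    - alpha%:R * ln b%:R / (alpha%:R - 1) by [].
split.
- by rewrite renyi_P_hat// gt_eqF.
- move=> bC db; rewrite rhoE VE /t tau_banded// !mul0r addr0.
  by rewrite /S -eq_energy_weight_sum// band_banded.
- rewrite rhoE lee_fin VE addrAC lerD2r.
  have le1 := le_energy_sum_tau (gram C) p sigma a0.
  have G0 : 0 < energy_sum alpha sigma (gram C) by exact: energy_sum_gt0.
  (* After clearing [alpha - 1], the term in [tau] is the logarithm of an exponential, so the claim
     is monotonicity of [ln] applied to [le_energy_sum_tau]. *)
  rewrite -(ler_pM2l a1') mulrDr !mulrA divff ?gt_eqF// !mul1r.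
  rewrite -[X in _ <= _ + X]expRK -lnM ?posrE ?mulr_gt0 ?expR_gt0//.
  rewrite ler_ln ?posrE ?mulr_gt0 ?expR_gt0//.
  apply: le_trans le1 _; rewrite -/t !mulrA.
  by apply: ler_wpM2r; first exact: expR_ge0.
- by rewrite (leq_trans timeE)// leq_account_time.
- by rewrite (leq_trans peakE)// leq_account_peak.
Qed.
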